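(* Let $\mathcal{Q}$ be a bipartite quiver represented by nontrivial finite-dimensional real Hilbert spaces $H_1,\dots,H_n$ (sources) and $H^1,\dots,H^m$ (targets) and surjective linear maps $B_a : H_i \to H^j$ for each arrow $a \in \mathcal{A}_{ij}$, where $\mathcal{A}_{ij}$ is the finite set of arrows from $H_i$ to $H^j$, and let $\mathbf{p} = (p_1,\dots,p_m)$ with $p_j \in [1,\infty]$ for each $1 \le j \le m$. Let $\alpha_j := \sum_{i=1}^n \#(\mathcal{A}_{ij})$. Let $\mathrm{BLCD}(\mathcal{Q},\mathbf{p}) \in [0,\infty]$ denote the smallest constant $C$ for which $$\prod_{i=1}^n \int_{H_i} \prod_{j=1}^m \prod_{a \in \mathcal{A}_{ij}} f_j(B_a x)\, dx \;\le\; C \prod_{i=1}^n \prod_{j=1}^m \prod_{a \in \mathcal{A}_{ij}} \|f_j\|_{L^{p_j}(H^j)} = C \prod_{j=1}^m \|f_j\|_{L^{p_j}(H^j)}^{\alpha_j}$$ holds for all measurable functions $f_j : H^j \to [0,\infty]$, $1 \le j \le m$ (one function for each target space). Then $\mathrm{BLCD}(\mathcal{Q},\mathbf{p})$ is finite if and only if both of the following conditions hold: $$\sum_{i=1}^n \dim(H_i) = \sum_{j=1}^m \alpha_j p_j^{-1} \dim(H^j)$$ and $$\sum_{i=1}^n \dim(V_i) \le \sum_{i=1}^n \sum_{j=1}^m \sum_{a \in \mathcal{A}_{ij}} p_j^{-1} \dim(B_a V_i) \quad \text{for all linear subspaces } V_1 \subseteq H_1, \dots, V_n \subseteq H_n.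$$
   Context: A quiver is a directed multigraph, here with finitely many vertices and arrows. It is bipartite if its vertex set is a disjoint union of two sets such that every arrow has its source in the first set and its target in the second. A representation assigns a vector space to each vertex and a linear map to each arrow (from the space at its source to the space at its target). Here the quiver is identified with a representation of it: the source vertices carry $H_1,\dots,H_n$, the target vertices carry $H^1,\dots,H^m$, and each arrow $a$ carries a surjective linear map $B_a$. Distinct vertices may carry equal spaces and distinct arrows may carry equal maps (multisets). ''Nontrivial'' means nonzero. Each Hilbert space carries the Lebesgue measure induced by its inner product. $\#(\cdot)$ denotes cardinality. Conventions: $1/\infty = 0$ and $0\cdot\infty = 0$; empty products, and zeroth powers, equal $1$. The constant $C$ is allowed to be infinite. *)

(* Defs.v *)
From HB Require Import structures.
From mathcomp Require Import all_boot all_order all_algebra sesquilinear.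
From mathcomp Require Import all_classical all_reals all_analysis.
From mathcomp Require Import measurable_realfun ring lra.

Set Implicit Arguments.
Unset Strict Implicit.
Unset Printing Implicit Defensive.

Import Order.TTheory GRing.Theory Num.Theory.
Import numFieldNormedType.Exports.

Local Open Scope classical_set_scope.
Local Open Scope ring_scope.

Section tuple_power_measure.
Context {d} {T : measurableType d} {R : realType}.

Definition tcons n (x : T * n.-tuple T) : n.+1.-tuple T :=
  [tuple of x.1 :: x.2].

Lemma measurable_tcons n : measurable_fun [set: T * n.-tuple T] (@tcons n).
Proof. exact: measurable_cons. Qed.

Section step.
Variables (mu : {sigma_finite_measure set T -> \bar R}) (n : nat).
Variable nu : {sigma_finite_measure set (n.-tuple T) -> \bar R}.

Definition tuple_power_step : set (n.+1.-tuple T) -> \bar R :=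
  pushforward (mu \x nu)%E (@tcons n).

Let step_measure : {measure set (n.+1.-tuple T) -> \bar R} :=
  measure_function_pushforward__canonical__measure_function_Measure
    (mu \x nu)%E (@measurable_tcons n).

HB.instance Definition _ := isMeasure.Build _ _ _ tuple_power_step
  (measure0 step_measure) (measure_ge0 step_measure)
  (@measure_semi_sigma_additive _ _ _ step_measure).

Let step_sigma_finite : sigma_finite [set: n.+1.-tuple T] tuple_power_step.
Proof.
have /sigma_finiteP[F [TF ndF Foo]] := sigma_finiteT mu.
have /sigma_finiteP[G [TG ndG Goo]] := sigma_finiteT nu.
pose h (t : n.+1.-tuple T) : T * n.-tuple T := (thead t, [tuple of behead t]).
have mh : measurable_fun setT h.
  apply: measurable_fun_pair; first exact: measurable_tnth.
  exact: measurable_behead.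
exists (fun k => h @^-1` (F k `*` G k)).
  rewrite -preimage_bigcup -(preimage_setT h); congr (_ @^-1` _).
  rewrite -setXTT TF TG predeqE => -[x y]; split.
    move=> [/= [k _ Fkx] [l _ Gly]]; exists (maxn k l) => //; split.
    - by move: x Fkx; exact/subsetPset/ndF/leq_maxl.
    - by move: y Gly; exact/subsetPset/ndG/leq_maxr.
  by move=> [k _ []/= ? ?]; split; exists k.
move=> k; have [mF Fk] := Foo k; have [mG Gk] := Goo k; split.
  by rewrite -[X in measurable X]setTI; apply: mh => //; exact: measurableX.
rewrite /tuple_power_step /pushforward -comp_preimage.
rewrite (_ : h \o @tcons n = id); last first.
  by apply/funext => -[x t] /=; rewrite /h /tcons /= theadE; congr pair; exact: val_inj.
by rewrite preimage_id product_measure1E// lte_mul_pinfty// ge0_fin_numE.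
Qed.

HB.instance Definition _ := @Measure_isSigmaFinite.Build _ _ _
  tuple_power_step step_sigma_finite.

End step.

Fixpoint tuple_power (mu : {sigma_finite_measure set T -> \bar R}) n :
    {sigma_finite_measure set (n.-tuple T) -> \bar R} :=
  match n with
  | 0 => \d_([tuple] : 0.-tuple T)
  | k.+1 => tuple_power_step mu (tuple_power mu k)
  end.

End tuple_power_measure.

Definition lebesgue_tuple (R : realType) n :
    {sigma_finite_measure set (n.-tuple (measurableTypeR R)) -> \bar R} :=
  tuple_power (@lebesgue_measure R) n.

(* Finite-dimensional real Hilbert spaces; completeness is automatic. *)
HB.mixin Record isFinHilbert (R : realType) V & Vector R V := {
  dotp : V -> V -> R;
  dotpC : forall u v, dotp u v = dotp v u;
  dotp_linear : forall v a u1 u2,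
    dotp (a *: u1 + u2) v = a * dotp u1 v + dotp u2 v;
  dotp_gt0 : forall v, v != 0 -> 0 < dotp v v
}.

#[short(type="finHilbertType")]
HB.structure Definition FinHilbert (R : realType) :=
  { V of Vector R V & isFinHilbert R V }.

Section dotp_instances.
Context {R : realType} (V : finHilbertType R).

Let dotp_bilinear : bilinear_for *%R (@idfun R \; *%R) (@dotp R V).
Proof.
split=> [v a u1 u2|u a v1 v2] /=; first exact: dotp_linear.
by rewrite ![dotp u _]dotpC dotp_linear.
Qed.

HB.instance Definition _ :=
  bilinear_isBilinear.Build R V V R _ _ (@dotp R V) dotp_bilinear.

Let dotp_hermitian (u v : V) : dotp u v = (-1) ^+ false * @idfun R (dotp v u).
Proof. by rewrite expr0 mul1r dotpC. Qed.

HB.instance Definition _ :=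
  isHermitianSesquilinear.Build R V false (@idfun R) (@dotp R V) dotp_hermitian.

HB.instance Definition _ := isDotProduct.Build R V (@dotp R V) (@dotp_gt0 R V).

End dotp_instances.

Section hilbert_borel.
Context {R : realType} (V : finHilbertType R).

Definition hilbert_ball (x : V) (r : R) : set V :=
  [set y | dotp (y - x) (y - x) < r ^+ 2].

Definition hilbert_open : set (set V) :=
  [set A | forall x, A x -> exists2 r, 0 < r & hilbert_ball x r `<=` A].

(* V with its Borel sigma-algebra; a copy of V, because an instance cannot be
   declared on the carrier of an arbitrary finHilbertType. *)
Definition borel : Type := V.

HB.instance Definition _ := Choice.on borel.
HB.instance Definition _ := isPointed.Build borel (0 : V).

Let borelC (A : set V) : <<s hilbert_open >> A -> <<s hilbert_open >> (~` A).
Proof. by move=> sA; rewrite -setTD; exact: sigma_algebraCD. Qed.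

HB.instance Definition _ := @isMeasurable.Build (sigma_display hilbert_open)
  borel <<s hilbert_open >> (@sigma_algebra0 _ setT hilbert_open)
  borelC (@sigma_algebra_bigcup _ setT hilbert_open).

End hilbert_borel.

Section lebesgue_hilbert.
Context {R : realType} (V : finHilbertType R).
Local Notation "''[' u , v ]" := (dotp u v).
Local Notation d := (\dim {: V}).

Let dot_suml (I : Type) (s : seq I) (P : pred I) (F : I -> V) v :
  '[\sum_(i <- s | P i) F i, v] = \sum_(i <- s | P i) '[F i, v].
Proof. exact: linear_sumlz. Qed.

Let dot_sumr (I : Type) (s : seq I) (P : pred I) (F : I -> V) v :
  '[v, \sum_(i <- s | P i) F i] = \sum_(i <- s | P i) '[v, F i].
Proof. exact: linear_sumr. Qed.

Lemma orthonormal_pairP (s : seq V) : orthonormal (@dotp R V) s ->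
  forall i j : 'I_(size s), '[s`_i, s`_j] = (i == j)%:R.
Proof.
elim: s => [_ []//|v s IH] /andP[/= /andP[/eqP v1 s1] /andP[vs ss]].
have {}IH : forall i j : 'I_(size s), '[s`_i, s`_j] = (i == j)%:R.
  by apply: IH; apply/andP.
have vs0 k : (k < size s)%N -> '[v, s`_k] = 0.
  move=> ks; move: vs; rewrite /ortho_rec /= andbT => /allP /(_ s`_k).
  by rewrite mem_nth// => /(_ isT) /eqP.
move=> [[|i] si] [[|j] sj] /=.
- by rewrite v1.
- by rewrite vs0.
- by rewrite dotpC vs0.
- by have /= -> := IH (Ordinal (si : (i < size s)%N)) (Ordinal (sj : (j < size s)%N)).
Qed.

Lemma exists_orthonormal_tuple k : (k <= d)%N ->
  exists e : k.-tuple V, orthonormal (@dotp R V) e.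
Proof.
elim: k => [_|k IH kd]; first by exists [tuple].
have [e oe] := IH (ltnW kd).
have : ~~ ({: V} <= <<e>>)%VS.
  apply/negP => /dimvS; have := dim_span e; rewrite size_tuple => ek dk.
  by have := leq_trans (leq_trans kd dk) ek; rewrite ltnn.
move=> /subvPn[v _ ve].
have oe' (i j : 'I_k) : '[e`_i, e`_j] = (i == j)%:R.
  have := orthonormal_pairP oe; rewrite size_tuple; exact.
pose w := v - \sum_(i < k) '[v, e`_i] *: e`_i.
have w0 : w != 0.
  apply: contra ve; rewrite subr_eq0 => /eqP ->.
  apply: memv_suml => i _; apply: memvZ; apply: memv_span.
  by apply: mem_nth; rewrite size_tuple.
have we (i : 'I_k) : '[w, e`_i] = 0.
  rewrite /w linearBl /= dot_suml (bigD1 i)//= big1 => [|j ji].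
    by rewrite linearZl_LR /= oe' eqxx mulr1 addr0 subrr.
  by rewrite linearZl_LR /= oe' (negPf ji) mulr0.
have ww : 0 < '[w, w] by exact: dotp_gt0.
exists [tuple of (Num.sqrt '[w, w])^-1 *: w :: e].
move: oe => /andP[e1 e2]; rewrite /orthonormal /= e1 e2 !andbT.
apply/andP; split.
  rewrite linearZl_LR/= linearZr_LR/= mulrA -expr2 exprVn sqr_sqrtr ?ltW//.
  by rewrite mulVf// gt_eqF.
apply/allP => x /(nthP 0)[i]; rewrite size_tuple => ik <-.
by rewrite /= linearZl_LR/= (we (Ordinal ik)) mulr0.
Qed.

Definition onbasis : d.-tuple V :=
  sval (cid (exists_orthonormal_tuple (leqnn d))).

Lemma onbasis_orthonormal : orthonormal (@dotp R V) onbasis.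
Proof. exact: (svalP (cid (exists_orthonormal_tuple (leqnn d)))). Qed.

(* The isometry R^d -> V determined by the orthonormal basis. *)
Definition of_coords (x : d.-tuple (measurableTypeR R)) : borel V :=
  \sum_(k < d) (tnth x k : R) *: tnth onbasis k.

Lemma dotp_of_coordsB (s t : d.-tuple (measurableTypeR R)) :
  '[of_coords s - of_coords t, of_coords s - of_coords t] =
  \sum_(k < d) ((tnth s k : R) - tnth t k) ^+ 2.
Proof.
have on (i j : 'I_d) : '[tnth onbasis i, tnth onbasis j] = (i == j)%:R.
  have := orthonormal_pairP onbasis_orthonormal; rewrite size_tuple => /(_ i j).
  by rewrite !(tnth_nth 0).
have -> : of_coords s - of_coords t =
    \sum_(k < d) ((tnth s k : R) - tnth t k) *: tnth onbasis k.
  by rewrite /of_coords -sumrB; apply: eq_bigr => k _; rewrite scalerBl.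
rewrite dot_suml; apply: eq_bigr => i _.
rewrite dot_sumr (bigD1 i)//= big1 => [|j ji].
  by rewrite linearZl_LR/= linearZr_LR/= on eqxx mulr1 addr0 expr2.
by rewrite linearZl_LR/= linearZr_LR/= on eq_sym (negPf ji) !mulr0.
Qed.

Lemma measurable_of_coords : measurable_fun setT of_coords.
Proof.
have gen := @measurability _ _ _ _ setT of_coords (@hilbert_open R V).
apply: gen => // _ [A oA <-].
rewrite setTI; set U := of_coords @^-1` A.
pose cube (qr : d.-tuple rat * rat) : set (d.-tuple (measurableTypeR R)) :=
  \bigcap_(k in [set: 'I_d])
    [set t | (tnth t k : R) \in
      `](ratr (tnth qr.1 k) - ratr qr.2), (ratr (tnth qr.1 k) + ratr qr.2)[].
have mcube qr : measurable (cube qr).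
  apply: fin_bigcap_measurable => [|k _]; first exact: finite_finset.
  rewrite -[X in measurable X]setTI.
  have mk := @measurable_tnth _ (measurableTypeR R) d k.
  exact: (mk measurableT _ (measurable_itv
    `](ratr (tnth qr.1 k) - ratr qr.2), (ratr (tnth qr.1 k) + ratr qr.2)[)).
pose F qr := if `[< cube qr `<=` U >] then cube qr else set0.
have -> : U = \bigcup_qr F qr.
  apply/seteqP; split => [t Ut|t [qr _]]; last first.
    by rewrite /F; case: asboolP => // cU /cU.
  have [r r0 rA] := oA _ Ut.
  pose e : R := r / (2 * d.+1%:R).
  have e0 : 0 < e by rewrite divr_gt0// mulr_gt0// ltr0n.
  have /rat_in_itvoo[rho] := e0; rewrite in_itv/= => /andP[rho0 rhoe].
  have /choice[q qP] (k : 'I_d) : exists q : rat,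
      ratr q \in `]((tnth t k : R) - ratr rho), (tnth t k + ratr rho)[.
    by apply: rat_in_itvoo; rewrite ltrBlDr -addrA ltrDl addr_gt0.
  pose qr := ([tuple q k | k < d], rho).
  have qrt : cube qr t.
    move=> k _ /=; rewrite tnth_mktuple; have := qP k; rewrite !in_itv/=.
    by move=> /andP[? ?]; apply/andP; split; lra.
  exists qr => //; rewrite /F asboolT// => s qrs.
  apply: rA; rewrite /hilbert_ball /= dotp_of_coordsB.
  have st (k : 'I_d) : ((tnth s k : R) - tnth t k) ^+ 2 <= (2 * e) ^+ 2.
    have := qrt k I; have := qrs k I; rewrite /= !in_itv/=.
    move=> /andP[? ?] /andP[? ?].
    rewrite -[leLHS]real_normK ?num_real// lerXn2r ?nnegrE//; first lra.
    by rewrite ler_norml; apply/andP; split; lra.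
  apply: (@le_lt_trans _ _ (\sum_(k < d) (2 * e) ^+ 2)); first exact: ler_sum.
  rewrite sumr_const card_ord -[ltLHS]mulr_natl /e.
  have d1 : (0 : R) < d.+1%:R by rewrite ltr0n.
  have -> : 2 * (r / (2 * d.+1%:R)) = r / d.+1%:R by field; rewrite gt_eqF.
  rewrite expr_div_n mulrCA gtr_pMr ?exprn_gt0//.
  rewrite ltr_pdivrMr ?exprn_gt0// mul1r -natrX ltr_nat.
  by rewrite expnS expn1 mulSn ltn_addr.
apply: countable_bigcupT_measurable => // qr.
by rewrite /F; case: asboolP.
Qed.

(* The choice of orthonormal basis is immaterial, since the Lebesgue measure on
   R^d is invariant under orthogonal maps. *)
Definition lebesgue_hilbert : set (borel V) -> \bar R :=
  pushforward (lebesgue_tuple R d) of_coords.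

Let lebesgue_hilbert_measure : {measure set (borel V) -> \bar R} :=
  measure_function_pushforward__canonical__measure_function_Measure
    (lebesgue_tuple R d) measurable_of_coords.

HB.instance Definition _ := isMeasure.Build _ _ _ lebesgue_hilbert
  (measure0 lebesgue_hilbert_measure) (measure_ge0 lebesgue_hilbert_measure)
  (@measure_semi_sigma_additive _ _ _ lebesgue_hilbert_measure).

End lebesgue_hilbert.
Arguments lebesgue_hilbert {R} V _.

(* A i j is the type of arrows from source i to target j. *)
Section quiver.
Context {R : realType} {n m : nat}.
Variables (H : 'I_n -> finHilbertType R) (K : 'I_m -> finHilbertType R).
Variable A : 'I_n -> 'I_m -> finType.

Definition alpha (j : 'I_m) : nat := (\sum_(i < n) #|A i j|)%N.

Local Open Scope ereal_scope.

Lemma prod_arrows (c : 'I_m -> \bar R) :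
  \prod_(i < n) \prod_(j < m) \prod_(a : A i j) c j =
  \prod_(j < m) c j ^+ alpha j.
Proof.
rewrite exchange_big /=; apply: eq_bigr => j _.
transitivity (\prod_(i < n) c j ^+ #|A i j|).
  by apply: eq_bigr => i _; rewrite big_const /expe Monoid.iteropE.
rewrite /alpha (big_morph (expe (c j)) (id1 := 1) (op1 := mule))// => k l.
by elim: k => [|k IH]; rewrite ?add0n ?mul1e// addSn !expeS IH muleA.
Qed.

Variable B : forall i j, A i j -> 'Hom(H i, K j).
Variable p : 'I_m -> \bar R.

Definition is_BLCD_constant (C : \bar R) : Prop :=
  0 <= C /\
  forall f : forall j, borel (K j) -> \bar R,
    (forall j, measurable_fun setT (f j)) ->
    (forall j y, 0 <= f j y) ->
    \prod_(i < n) \int[lebesgue_hilbert (H i)]_x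
        \prod_(j < m) \prod_(a : A i j) f j (B a x)
    <= C * \prod_(i < n) \prod_(j < m) \prod_(a : A i j)
             'N[lebesgue_hilbert (K j)]_(p j)[f j].

(* The infimum is attained, so this is the smallest constant; it is +oo if no
   finite constant is admissible. *)
Definition BLCD : \bar R := ereal_inf [set C | is_BLCD_constant C].

End quiver.

(* 1/p, with the convention 1/oo = 0. *)
Definition recip {R : realType} (p : \bar R) : R := fine p^-1%E.

(* Main.v *)
(* If the constant is finite, take one set per arrow and let [f j] be built from
   the sum of the normalised indicators of the sets of the arrows into [j]: up to
   a factor, this gives the inequality with one indicator per arrow. Testing it
   on boxes stretched by a factor [t] along [V i] and along the images
   [B a (V i)] gives [t ^ (sum dim V i - sum dim (B a (V i)) / p j) <= C]; let
   [t] tend to infinity, and to 0 when every [V i] is the whole space.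

   Conversely, the subspace condition applied to one source at a time shows that
   the sources decouple, so that each integral is an ordinary Brascamp-Lieb form,
   and one follows Bennett, Carbery, Christ and Tao. Written for
   [g j = f j ^ p j], the inequality with exponents [s j = 1 / p j] is stable
   under convex combinations of [s], by Hoelder's inequality, and it factors
   through any critical subspace (one with equality in the condition), by
   Fubini. If there is no proper critical subspace, either some [s j = 1] and
   [B j] is bijective, or two exponents lie strictly between 0 and 1; then [s] is
   moved in both directions along a line preserving the scaling identity until
   an exponent becomes integral or a critical subspace appears. Arrows with
   [p j = oo] have exponent 0 and contribute an essential supremum. *)

Require Import Defs.
From HB Require Import structures.
From mathcomp Require Import all_boot all_order all_algebra.
From mathcomp Require Import all_classical all_reals all_analysis.
From mathcomp Require Import measurable_realfun ess_sup_inf ring lra.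

Set Implicit Arguments.
Unset Strict Implicit.
Unset Printing Implicit Defensive.

Import Order.TTheory GRing.Theory Num.Theory.

Local Open Scope classical_set_scope.
Local Open Scope ring_scope.

(** * Lebesgue measure on finite-dimensional Hilbert spaces *)

Section coordinates.
Context {R : realType} (V : finHilbertType R).
Local Notation "''[' u , v ]" := (dotp u v).
Local Notation d := (\dim {: V}).
Local Notation e := (@onbasis R V).

Lemma dotp_onbasis (i j : 'I_d) : '[tnth e i, tnth e j] = (i == j)%:R.
Proof.
have := orthonormal_pairP (onbasis_orthonormal V); rewrite size_tuple => /(_ i j).
by rewrite !(tnth_nth 0).
Qed.

Lemma dotp_sumr (I : Type) (s : seq I) (P : pred I) (F : I -> V) v :
  '[v, \sum_(i <- s | P i) F i] = \sum_(i <- s | P i) '[v, F i].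
Proof. exact: linear_sumr. Qed.

Lemma dotp_suml (I : Type) (s : seq I) (P : pred I) (F : I -> V) v :
  '[\sum_(i <- s | P i) F i, v] = \sum_(i <- s | P i) '[F i, v].
Proof. exact: linear_sumlz. Qed.

Lemma dotpDl (u v w : V) : '[u + v, w] = '[u, w] + '[v, w].
Proof. exact: linearDl. Qed.

Lemma dotpNl (u v : V) : '[- u, v] = - '[u, v].
Proof. exact: linearNl. Qed.

Lemma dotpZl a (u v : V) : '[a *: u, v] = a * '[u, v].
Proof. by rewrite linearZl_LR. Qed.

Lemma dotpZr a (u v : V) : '[u, a *: v] = a * '[u, v].
Proof. by rewrite linearZr_LR. Qed.

Lemma dotp_of_coords t (k : 'I_d) : '[of_coords t : V, tnth e k] = tnth t k.
Proof.
rewrite /of_coords dotp_suml (bigD1 k)//= big1 => [|j jk].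
  by rewrite dotpZl dotp_onbasis eqxx mulr1 addr0.
by rewrite dotpZl dotp_onbasis (negPf jk) mulr0.
Qed.

Lemma onbasis_expansion (x : V) : x = \sum_(k < d) '[x, tnth e k] *: tnth e k.
Proof.
have fe : free e.
  apply/freeP => c c0 i.
  have : '[\sum_(i < d) c i *: e`_i, tnth e i] = 0 by rewrite c0 linear0l.
  rewrite dotp_suml (bigD1 i)//= big1 => [|j ji].
    by rewrite dotpZl -tnth_nth dotp_onbasis eqxx mulr1 addr0.
  by rewrite dotpZl -tnth_nth dotp_onbasis (negPf ji) mulr0.
have be : basis_of {: V} e.
  by rewrite basisEfree fe subvf size_tuple leqnn.
have /coord_span xE : x \in <<e>>%VS by rewrite (span_basis be) memvf.
rewrite [LHS]xE; apply: eq_bigr => k _; rewrite -tnth_nth; congr (_ *: _).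
rewrite [in RHS]xE dotp_suml (bigD1 k)//= big1 => [|j jk].
  by rewrite dotpZl -tnth_nth dotp_onbasis eqxx mulr1 addr0.
by rewrite dotpZl -tnth_nth dotp_onbasis (negPf jk) mulr0.
Qed.

Definition to_coords (x : borel V) : d.-tuple (measurableTypeR R) :=
  [tuple dotp (x : V) (tnth e k) | k < d].

Lemma to_coordsK : cancel to_coords (@of_coords R V).
Proof.
move=> x; rewrite [RHS](onbasis_expansion x); apply: eq_bigr => k _.
by rewrite tnth_mktuple.
Qed.

Lemma of_coordsK : cancel (@of_coords R V) to_coords.
Proof.
by move=> t; apply: eq_from_tnth => k; rewrite tnth_mktuple dotp_of_coords.
Qed.

(** The preimage of an open ray is open in the sense of [hilbert_open]: by Bessel's inequality a
    coordinate varies by no more than the norm, so the ball of radius ['[x, tnth e k] - c] around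
    [x] stays inside. *)
Lemma measurable_dotp_onbasis (k : 'I_d) :
  measurable_fun setT (fun x : borel V => dotp (x : V) (tnth e k) : measurableTypeR R).
Proof.
apply: (measurability _ (RGenOInfty.measurableE R)) => //.
move=> _ [_ [c ->] <-]; rewrite setTI; apply: sub_gen_smallest => x /=.
rewrite in_itv/= andbT => cx; exists ('[x, tnth e k] - c).
  by rewrite subr_gt0.
move=> y /= yx; rewrite in_itv/= andbT.
have : '[y - x, tnth e k] ^+ 2 <= '[y - x, y - x].
  rewrite [X in _ <= '[_, X]](onbasis_expansion (y - x)) dotp_sumr (bigD1 k)//=.
  by rewrite dotpZr -expr2 lerDl sumr_ge0// => j _; rewrite dotpZr -expr2 sqr_ge0.
move=> /le_lt_trans/(_ yx); rewrite dotpDl dotpNl => lt2.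
rewrite ltNge; apply/negP => yc; move: lt2; rewrite ltNge => /negP; apply.
by rewrite -[leRHS]sqrrN ler_sqr ?nnegrE; lra.
Qed.

Lemma measurable_linear_form (phi : V -> R) :
    (forall a u v, phi (a *: u + v) = a * phi u + phi v) ->
  measurable_fun setT (fun x : borel V => phi (x : V) : measurableTypeR R).
Proof.
move=> phil.
have phi0 : phi 0 = 0 by have := phil (-1) 0 0; rewrite scaler0 addr0 mulN1r addNr.
have phiD u v : phi (u + v) = phi u + phi v by rewrite -[u]scale1r phil mul1r scale1r.
have phiZ a u : phi (a *: u) = a * phi u by rewrite -[a *: u]addr0 phil phi0 addr0.
rewrite [X in measurable_fun _ X](_ : _ = fun x : borel V =>
    \sum_(k < d) dotp (x : V) (tnth e k) * phi (tnth e k)); last first.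
  apply/funext => x; rewrite {1}(onbasis_expansion x) (big_morph phi phiD phi0).
  by apply: eq_bigr => k _; rewrite phiZ.
apply: measurable_sum => k; apply: measurable_funM => //.
exact: measurable_dotp_onbasis.
Qed.

Lemma measurable_dotp (v : V) :
  measurable_fun setT (fun x : borel V => dotp (x : V) v : measurableTypeR R).
Proof.
apply: (@measurable_linear_form (fun x : V => '[x, v])) => a x y.
exact: dotp_linear.
Qed.

Lemma measurable_to_coords : measurable_fun setT to_coords.
Proof.
apply/measurable_fun_tnthP => k.
rewrite [X in measurable_fun _ X](_ : _ =
    fun x : borel V => dotp (x : V) (tnth e k) : measurableTypeR R).
  exact: measurable_dotp_onbasis.
by apply/funext => x; rewrite /= tnth_mktuple.
Qed.

(** Since [of_coords] is measurable and inverts [to_coords], measurability into [borel V] can be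
    tested on coordinates. *)
Lemma measurable_fun_borel d' (X : measurableType d') (F : X -> borel V) :
    (forall v : V, measurable_fun setT (fun x => dotp (F x : V) v : measurableTypeR R)) ->
  measurable_fun setT F.
Proof.
move=> mF; rewrite (_ : F = @of_coords R V \o (to_coords \o F)).
  apply: measurableT_comp; first exact: measurable_of_coords.
  apply/measurable_fun_tnthP => k.
  rewrite [X in measurable_fun _ X](_ : _ =
      fun x => dotp (F x : V) (tnth e k) : measurableTypeR R).
    exact: mF.
  by apply/funext => x; rewrite /= tnth_mktuple.
by apply/funext => x /=; rewrite to_coordsK.
Qed.

End coordinates.

Lemma measurable_hom {R : realType} (V W : finHilbertType R) (f : 'Hom(V, W)) :
  measurable_fun setT (f : borel V -> borel W).
Proof.
apply: measurable_fun_borel => w.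
apply: (@measurable_linear_form _ _ (fun x => dotp (f x) w)) => a u v.
by rewrite linearP dotp_linear.
Qed.

Lemma measurable_borelD {R : realType} (V : finHilbertType R) d (X : measurableType d)
    (F G : X -> borel V) :
  measurable_fun setT F -> measurable_fun setT G ->
  measurable_fun setT (fun x => (F x : V) + G x : borel V).
Proof.
move=> mF mG; apply: measurable_fun_borel => v.
rewrite [X in measurable_fun _ X](_ : _ = fun x => dotp (F x : V) v + dotp (G x : V) v).
  apply: measurable_funD.
    exact: (measurableT_comp (@measurable_dotp R V v) mF).
  exact: (measurableT_comp (@measurable_dotp R V v) mG).
by apply/funext => x; rewrite dotpDl.
Qed.

(** * Translation invariance and uniqueness of Lebesgue measure *)

Lemma lebesgue_measureD {R : realType} (c : R) (A : set (measurableTypeR R)) :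
  measurable A -> lebesgue_measure ((fun x => x + c) @^-1` A) = lebesgue_measure A.
Proof.
move=> mA; have mD : measurable_fun setT
    (fun x : measurableTypeR R => (x + c : measurableTypeR R)).
  exact: measurable_funD.
pose nu := measure_function_pushforward__canonical__measure_function_Measure
    (@lebesgue_measure R) mD.
(* Lebesgue measure is determined by its values on half-open intervals, so only these are
   compared. *)
apply/esym; apply: (@lebesgue_measure_unique _ nu) => //= _ [[a b]] _ <-.
rewrite /nu /= /pushforward (_ : _ @^-1` _ = `](a - c), (b - c)]%classic).
  rewrite !lebesgue_measure_itv/= !lte_fin ltrD2r -!EFinB.
  by rewrite (_ : b - c - (a - c) = b - a); last ring.
by apply/seteqP; split => x /=; rewrite !in_itv/= ltrBlDr lerBrDr.
Qed.

Section lebesgue_tuple.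
Context {R : realType}.
Local Notation T := (measurableTypeR R).

Lemma ge0_integral_lebesgue_tupleS n (f : n.+1.-tuple T -> \bar R) :
    measurable_fun setT f -> (forall t, 0 <= f t)%E ->
  (\int[lebesgue_tuple R n.+1]_t f t =
   \int[lebesgue_measure]_x \int[lebesgue_tuple R n]_t f (tcons (x, t)))%E.
Proof.
move=> mf f0; rewrite /lebesgue_tuple /=.
rewrite (@ge0_integral_pushforward _ _ _ _ _ _ (@measurable_tcons _ T n))//.
rewrite preimage_setT fubini_tonelli1 => [//||x]; last exact: f0.
by apply: measurableT_comp => //; exact: measurable_tcons.
Qed.

Definition addt n (t v : n.-tuple T) : n.-tuple T :=
  [tuple (tnth t k : R) + tnth v k | k < n].

Lemma measurable_addt n (v : n.-tuple T) : measurable_fun setT (@addt n ^~ v).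
Proof.
apply/measurable_fun_tnthP => k.
rewrite [X in measurable_fun _ X](_ : _ = fun t => ((tnth t k : R) + tnth v k : T)).
  by apply: measurable_funD => //; exact: measurable_tnth.
by apply/funext => t /=; rewrite tnth_mktuple.
Qed.

(** Tonelli peels off the first coordinate: the induction hypothesis shifts the remaining ones,
    [lebesgue_measureD] the first. *)
Lemma ge0_integral_addt n (v : n.-tuple T) (f : n.-tuple T -> \bar R) :
    measurable_fun setT f -> (forall t, 0 <= f t)%E ->
  (\int[lebesgue_tuple R n]_t f (addt t v) = \int[lebesgue_tuple R n]_t f t)%E.
Proof.
elim: n v f => [v f mf f0|n IH v f mf f0].
  by apply: eq_integral => t _; rewrite [addt t v]tuple0 [t]tuple0.
have mfa : measurable_fun setT (fun t => f (addt t v)).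
  exact: (measurableT_comp mf (measurable_addt v)).
rewrite !ge0_integral_lebesgue_tupleS//.
pose F x := (\int[lebesgue_tuple R n]_t f (tcons (x, t)))%E.
have mfc : measurable_fun setT (fun z => f (tcons z)).
  by apply: measurableT_comp => //; exact: measurable_tcons.
have mF : measurable_fun setT F.
  exact: (measurable_fun_fubini_tonelli_F (fun z => f (tcons z))).
have F0 x : (0 <= F x)%E by apply: integral_ge0.
transitivity (\int[lebesgue_measure]_x F ((x + tnth v ord0)%R : T))%E.
  apply: eq_integral => x _.
  rewrite /F -[RHS](IH [tuple of behead v]); last 2 first.
  - by apply: (measurableT_comp mfc); exact: measurable_pair1.
  - by move=> t.
  apply: eq_integral => t _; congr (f _); apply: eq_from_tnth => k.
  rewrite tnth_mktuple; case: (unliftP ord0 k) => [j ->|->].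
    rewrite !tnthS/= tnth_mktuple tnth_behead; congr (_ + tnth v _).
    by apply: val_inj; rewrite /= inordK// ltnS.
  by rewrite !tnth0.
have mD : measurable_fun setT (fun x : T => (x + tnth v ord0 : T)).
  exact: measurable_funD.
rewrite -(@ge0_integral_pushforward _ _ _ _ _ _ mD _ setT F)//.
apply: eq_measure_integral => A mA _.
exact: lebesgue_measureD.
Qed.

Lemma lebesgue_tuple_cube n (A : set T) : measurable A ->
  lebesgue_tuple R n [set t | forall k, A (tnth t k)] = (lebesgue_measure A ^+ n)%E.
Proof.
move=> mA; elim: n => [|n IH].
  rewrite /lebesgue_tuple/= diracE mem_set//=.
  by case.
rewrite expeS /lebesgue_tuple/= /tuple_power_step /pushforward.
rewrite (_ : _ @^-1` _ = A `*` [set t : n.-tuple T | forall k, A (tnth t k)]).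
  rewrite product_measure1E//; last first.
    rewrite (_ : mkset _ = \bigcap_(k in [set: 'I_n]) ((fun t => tnth t k) @^-1` A)).
      apply: fin_bigcap_measurable => [|k _]; first exact: finite_finset.
      by rewrite -[X in measurable X]setTI; exact: measurable_tnth.
    by apply/seteqP; split => [t h k _|t h k]; exact: h.
  by rewrite IH.
apply/seteqP; split => [[x t] /= h|[x t] [/= xA h] k].
  split; first by have := h ord0; rewrite tnth0.
  by move=> k; have := h (lift ord0 k); rewrite tnthS.
by case: (unliftP ord0 k) => [j ->|->]; rewrite ?tnthS ?tnth0.
Qed.

End lebesgue_tuple.

Lemma measurable_borelN {R : realType} (V : finHilbertType R) :
  measurable_fun setT (fun x : borel V => - (x : V) : borel V).
Proof.
apply: measurable_fun_borel => v.
apply: (@measurable_linear_form _ _ (fun x : V => dotp (- x) v)) => a x y.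
by rewrite !dotpNl dotp_linear opprD mulrN.
Qed.

Section lebesgue_hilbert_theory.
Context {R : realType} (V : finHilbertType R).
Local Notation T := (measurableTypeR R).
Local Notation d := (\dim {: V}).
Local Open Scope ereal_scope.

Lemma ge0_integral_lebesgue_hilbert (f : borel V -> \bar R) :
    measurable_fun setT f -> (forall x, 0 <= f x) ->
  \int[lebesgue_hilbert V]_x f x = \int[lebesgue_tuple R d]_t f (of_coords t).
Proof.
move=> mf f0; rewrite /lebesgue_hilbert.
by rewrite (ge0_integral_pushforward (@measurable_of_coords R V))// preimage_setT.
Qed.

Let lebesgue_hilbert_sigma_finite : sigma_finite setT (@lebesgue_hilbert R V).
Proof.
have [F TF Foo] := sigma_finiteT (lebesgue_tuple R d).
exists (fun k => @to_coords R V @^-1` F k).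
  by rewrite -preimage_bigcup -TF preimage_setT.
move=> k; have [mF Fk] := Foo k; split.
  by rewrite -[X in measurable X]setTI; exact: measurable_to_coords.
rewrite /lebesgue_hilbert /pushforward -comp_preimage.
rewrite (_ : _ \o _ = id) ?preimage_id//.
by apply/funext => t /=; rewrite of_coordsK.
Qed.

HB.instance Definition _ := @Measure_isSigmaFinite.Build _ _ _
  (@lebesgue_hilbert R V) lebesgue_hilbert_sigma_finite.

Lemma of_coords_addt (t s : d.-tuple T) :
  (of_coords (addt t s) : V) = ((of_coords t : V) + of_coords s)%R.
Proof.
rewrite /of_coords -big_split; apply: eq_bigr => k _.
by rewrite tnth_mktuple scalerDl.
Qed.

Lemma measurable_shift (v : V) :
  measurable_fun setT (fun x : borel V => ((x : V) + v)%R : borel V).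
Proof. exact: measurable_borelD. Qed.

Lemma ge0_integral_shift (v : V) (f : borel V -> \bar R) :
    measurable_fun setT f -> (forall x, 0 <= f x) ->
  \int[lebesgue_hilbert V]_x f ((x : V) + v)%R = \int[lebesgue_hilbert V]_x f x.
Proof.
move=> mf f0; rewrite !ge0_integral_lebesgue_hilbert//; last first.
  exact: (measurableT_comp mf (measurable_shift v)).
rewrite -[RHS](@ge0_integral_addt _ _ (to_coords (v : borel V)))//; last first.
  by apply: measurableT_comp => //; exact: measurable_of_coords.
by apply: eq_integral => t _; rewrite of_coords_addt to_coordsK.
Qed.

(** Cubes in the coordinates of [onbasis] serve better than balls: their volume is an explicit
    power, correct also in dimension 0. *)
Definition hilbert_box (r : R) : set (borel V) :=
  [set x | forall k, (`|dotp (x : V) (tnth (@onbasis R V) k)| <= r)%R].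

Lemma hilbert_boxE r : hilbert_box r =
  @to_coords R V @^-1` [set t | forall k, `[(- r)%R, r]%classic (tnth t k)].
Proof.
by apply/seteqP; split=> x h k; have := h k;
  rewrite ?tnth_mktuple /= in_itv/= -ler_norml ?tnth_mktuple.
Qed.

Lemma measurable_hilbert_box r : measurable (hilbert_box r).
Proof.
rewrite (_ : hilbert_box r = \bigcap_(k in [set: 'I_d])
  ((fun x : borel V => dotp (x : V) (tnth (@onbasis R V) k) : T) @^-1` `[(- r)%R, r]%classic)).
  apply: fin_bigcap_measurable => [|k _]; first exact: finite_finset.
  rewrite -[X in measurable X]setTI.
  by apply: measurable_dotp => //; exact: measurable_itv.
by apply/seteqP; split=> [x h k _|x h k]; have := h k;
  rewrite /= in_itv/= -ler_norml; apply.
Qed.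

Lemma lebesgue_hilbert_box r : (0 < r)%R ->
  lebesgue_hilbert V (hilbert_box r) = ((2 * r) ^+ d)%:E.
Proof.
move=> r0; rewrite hilbert_boxE /lebesgue_hilbert /pushforward -comp_preimage.
rewrite (_ : _ \o _ = id); last by apply/funext => t /=; rewrite of_coordsK.
rewrite preimage_id lebesgue_tuple_cube//.
rewrite lebesgue_measure_itv/= lte_fin (_ : - r < r)%R; last lra.
rewrite -EFinB (_ : r - - r = 2 * r)%R; last ring.
by elim: d => [|n IH]; rewrite ?expe0 ?expr0// expeS exprS IH EFinM.
Qed.

Lemma lebesgue_hilbert_gt0 : 0 < lebesgue_hilbert V setT.
Proof.
apply: (@lt_le_trans _ _ (lebesgue_hilbert V (hilbert_box 1))).
  by rewrite lebesgue_hilbert_box// lte_fin exprn_gt0// mulr1.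
by apply: le_measure; rewrite ?inE//; exact: measurable_hilbert_box.
Qed.

(* Both sides are iterated integrals of [f x * g (x + y)]: Fubini and the
   substitutions [y |-> y + x] and [x |-> x - y]. *)
Lemma invariant_integral_mul (mu nu : {sigma_finite_measure set (borel V) -> \bar R})
    (f g : borel V -> \bar R) :
    (forall v (h : borel V -> \bar R), measurable_fun setT h -> (forall x, 0 <= h x) ->
      \int[mu]_x h ((x : V) + v)%R = \int[mu]_x h x) ->
    (forall v (h : borel V -> \bar R), measurable_fun setT h -> (forall x, 0 <= h x) ->
      \int[nu]_x h ((x : V) + v)%R = \int[nu]_x h x) ->
    measurable_fun setT f -> (forall x, 0 <= f x) ->
    measurable_fun setT g -> (forall x, 0 <= g x) ->
  (\int[nu]_x f x) * (\int[mu]_x g x) =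
  (\int[nu]_x g x) * (\int[mu]_x f (- (x : V))%R).
Proof.
move=> muD nuD mf f0 mg g0.
have mN : measurable_fun setT (fun x : borel V => (- (x : V))%R : borel V).
  exact: measurable_borelN.
have mDp (h : borel V -> \bar R) : measurable_fun setT h ->
    measurable_fun setT (fun z : borel V * borel V => h ((z.1 : V) + z.2)%R).
  by move=> mh; apply: (measurableT_comp mh); exact: measurable_borelD.
have mNf : measurable_fun setT (fun x : borel V => f (- (x : V))%R).
  exact: (measurableT_comp mf mN).
have ms (h : borel V -> \bar R) v : measurable_fun setT h ->
    measurable_fun setT (fun x : borel V => h ((x : V) + v)%R).
  by move=> mh; exact: (measurableT_comp mh (measurable_shift v)).
transitivity (\int[nu]_x \int[mu]_y (f x * g ((x : V) + y)%R)).
  rewrite -ge0_integralZr//; last exact: integral_ge0.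
  apply: eq_integral => x _; rewrite ge0_integralZl//; last first.
    by under eq_fun do rewrite addrC; exact: ms.
  by under [in RHS]eq_integral do rewrite addrC; rewrite muD.
rewrite (fubini_tonelli (fun z : borel V * borel V =>
  f z.1 * g ((z.1 : V) + z.2)%R))//=; last 2 first.
- apply: emeasurable_funM; last exact: mDp.
  exact: (measurableT_comp mf measurable_fst).
- by move=> z; apply: mule_ge0.
transitivity (\int[mu]_y \int[nu]_x (f ((x : V) - y)%R * g x)).
  apply: eq_integral => y _.
  rewrite -[RHS](nuD (y : V))//.
  - by apply: eq_integral => x _; rewrite addrK.
  - by apply: emeasurable_funM => //; exact: ms.
  - by move=> x; apply: mule_ge0.
rewrite -(fubini_tonelli (fun z : borel V * borel V =>
  f ((z.1 : V) - z.2)%R * g z.1))//=; last 2 first.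
- apply: emeasurable_funM; last exact: (measurableT_comp mg measurable_fst).
  apply: (measurableT_comp mf); apply: measurable_borelD => //.
  exact: (measurableT_comp mN measurable_snd).
- by move=> z; apply: mule_ge0.
have mxN (x : borel V) : measurable_fun setT (fun y : borel V => f ((x : V) - (y : V))%R).
  apply: (measurableT_comp mf).
  have := measurable_borelD (measurable_cst (x : borel V)) mN.
  by [].
rewrite -ge0_integralZr//; last exact: integral_ge0.
apply: eq_integral => x _; rewrite ge0_integralZr// muleC; congr (_ * _).
rewrite -(muD (x : V) (fun y : borel V => f ((x : V) - y)%R))//.
by apply: eq_integral => y _; rewrite opprD addrCA subrr addr0.
Qed.

(* The measure [nu] need not be finite on compact sets a priori: sigma-finiteness
   gives one set of finite positive measure, which fixes the ratio. *)
Lemma invariant_integral_unique (nu : {sigma_finite_measure set (borel V) -> \bar R}) :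
    (forall v (h : borel V -> \bar R), measurable_fun setT h -> (forall x, 0 <= h x) ->
      \int[nu]_x h ((x : V) + v)%R = \int[nu]_x h x) ->
    0 < nu setT ->
  exists2 c : R, (0 < c)%R & forall f : borel V -> \bar R,
    measurable_fun setT f -> (forall x, 0 <= f x) ->
    \int[nu]_x f x = c%:E * \int[lebesgue_hilbert V]_x f x.
Proof.
move=> nuD nu0.
pose mu : {sigma_finite_measure set (borel V) -> \bar R} := lebesgue_hilbert V.
have muD : forall v (h : borel V -> \bar R), measurable_fun setT h ->
    (forall x, 0 <= h x) -> \int[mu]_x h ((x : V) + v)%R = \int[mu]_x h x.
  by move=> v h; exact: ge0_integral_shift.
pose B := hilbert_box 1; have mB : measurable B := measurable_hilbert_box 1.
pose g x : \bar R := (\1_B x)%:E.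
have mg : measurable_fun setT g by exact/measurable_EFinP.
have g0 x : 0 <= g x by rewrite lee_fin.
have lg : \int[mu]_x g x = (2 ^+ d)%:E.
  by rewrite integral_indic// setIT; have := lebesgue_hilbert_box ltr01; rewrite mulr1.
have b0 : (0 < 2 ^+ d :> R)%R by rewrite exprn_gt0.
(* With [nu := mu] the product identity has the same box factor on both sides; cancelling it shows
   that Lebesgue measure is invariant under reflection. *)
have muN (f : borel V -> \bar R) : measurable_fun setT f -> (forall x, 0 <= f x) ->
    \int[mu]_x f (- (x : V))%R = \int[mu]_x f x.
  move=> mf f0; have := invariant_integral_mul muD muD mf f0 mg g0.
  rewrite lg muleC => /(congr1 (fun z => (2 ^+ d)^-1%:E * z)).
  by rewrite !muleA -EFinM mulVf ?gt_eqF// !mul1e.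
have key (f : borel V -> \bar R) : measurable_fun setT f -> (forall x, 0 <= f x) ->
    \int[nu]_x f x * (2 ^+ d)%:E = \int[nu]_x g x * \int[mu]_x f x.
  by move=> mf f0; rewrite -lg (invariant_integral_mul muD nuD mf f0 mg g0) muN.
(* With [f := 1] in [key], a box of measure 0 would force [nu setT = 0]. *)
have g_gt0 : 0 < \int[nu]_x g x.
  rewrite lt0e integral_ge0// andbT; apply/eqP => ng0.
  have := key (cst 1) (measurable_cst _) (fun=> lee01).
  rewrite ng0 mul0e integral_cst// mul1e => /eqP.
  by rewrite mule_eq0 gt_eqF//= eqe gt_eqF.
have g_fin : \int[nu]_x g x < +oo.
  have [F TF Foo] := sigma_finiteT nu.
  have [k Fk0] : exists k, 0 < nu (F k).
    apply: contrapT => /forallNP F0; move: nu0; rewrite TF.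
    have : nu.-negligible (\bigcup_k F k).
      apply: negligible_bigcup => k; have [mF _] := Foo k.
      apply/negligibleP => //; apply/eqP; rewrite eq_le measure_ge0 andbT leNgt.
      exact/negP/F0.
    by rewrite -TF => /negligibleP-/(_ measurableT) ->; rewrite ltxx.
  have [mF Fk] := Foo k.
  have kF : nu (F k) * (2 ^+ d)%:E = \int[nu]_x g x * mu (F k).
    rewrite -(setIT (F k)) -!integral_indic// key//; exact/measurable_EFinP.
  (* If the box had infinite measure, [kF] would equate a finite positive number with
     [+oo * mu (F k)], which is 0 or [+oo]. *)
  rewrite ltey; apply/eqP => gy; move: kF; rewrite gy => kF.
  have : 0 < +oo * mu (F k).
    by rewrite -kF mule_gt0.
  have [->|F0 _] := eqVneq (mu (F k)) 0; first by rewrite mule0 ltxx.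
  have F_gt0 : 0 < mu (F k) by rewrite lt0e F0 measure_ge0.
  move: kF; rewrite gt0_mulye//.
  by rewrite -(fineK (_ : nu (F k) \is a fin_num)) ?ge0_fin_numE// -EFinM.
pose c := (fine (\int[nu]_x g x) / 2 ^+ d)%R.
have gE : \int[nu]_x g x = (fine (\int[nu]_x g x))%:E.
  by rewrite fineK// ge0_fin_numE// integral_ge0.
exists c => [|f mf f0]; first by rewrite divr_gt0// fine_gt0// g_gt0.
have := key f mf f0; rewrite gE => kf.
rewrite /c EFinM muleAC -kf -muleA -EFinM mulfV ?mule1// gt_eqF//.
Qed.

End lebesgue_hilbert_theory.

(** * Linear changes of variables and Fubini along direct sums *)

Section transport.
Context {R : realType} (V : finHilbertType R) {d : measure_display}.
Context (X : measurableType d) (mu : {measure set X -> \bar R}).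
Hypothesis mu_sigma_finite : sigma_finite setT mu.
Variables (phi : X -> borel V) (psi : borel V -> X) (tau : V -> X -> X).
Hypotheses (mphi : measurable_fun setT phi) (mpsi : measurable_fun setT psi).
Hypothesis phiK : cancel phi psi.
Hypothesis phi_tau : forall v x, phi (tau v x) = (phi x : V) + v.
Hypothesis mu_tau : forall v (h : X -> \bar R), measurable_fun setT h ->
  (forall x, 0 <= h x)%E -> (\int[mu]_x h (tau v x) = \int[mu]_x h x)%E.
Hypothesis mu_gt0 : (0 < mu setT)%E.
Local Open Scope ereal_scope.

Let nu : set (borel V) -> \bar R := pushforward mu phi.

Let nu_measure : {measure set (borel V) -> \bar R} :=
  measure_function_pushforward__canonical__measure_function_Measure mu mphi.

HB.instance Definition _ := isMeasure.Build _ _ _ nu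
  (measure0 nu_measure) (measure_ge0 nu_measure)
  (@measure_semi_sigma_additive _ _ _ nu_measure).

Let nu_sigma_finite : sigma_finite setT nu.
Proof.
have [F TF Foo] := mu_sigma_finite.
exists (fun k => psi @^-1` F k); first by rewrite -preimage_bigcup -TF preimage_setT.
move=> k; have [mF Fk] := Foo k; split.
  by rewrite -[X in measurable X]setTI; exact: mpsi.
rewrite /nu /pushforward -comp_preimage (_ : _ \o _ = id) ?preimage_id//.
by apply/funext => x /=; rewrite phiK.
Qed.

HB.instance Definition _ := @Measure_isSigmaFinite.Build _ _ _ nu nu_sigma_finite.

Let integral_nu (f : borel V -> \bar R) : measurable_fun setT f ->
  (forall x, 0 <= f x) -> \int[nu]_x f x = \int[mu]_x f (phi x).
Proof.
by move=> mf f0; rewrite /nu (ge0_integral_pushforward mphi)// preimage_setT.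
Qed.

(** The pushforward of [mu] along [phi] is translation invariant because [tau] lifts the
    translations of [V]; by uniqueness it is a multiple of Lebesgue measure. This serves linear
    bijections and product decompositions alike. *)
Lemma integral_transport : exists2 c : R, (0 < c)%R &
  forall f : borel V -> \bar R, measurable_fun setT f -> (forall x, 0 <= f x) ->
    \int[mu]_x f (phi x) = c%:E * \int[lebesgue_hilbert V]_x f x.
Proof.
have nuD v (h : borel V -> \bar R) : measurable_fun setT h ->
    (forall x, 0 <= h x) -> \int[nu]_x h ((x : V) + v)%R = \int[nu]_x h x.
  move=> mh h0; have ms := measurableT_comp mh (measurable_shift v).
  rewrite !integral_nu//.
  rewrite -[RHS](mu_tau v); last 2 first.
  + exact: measurableT_comp.
  + by move=> x; exact: h0.
  by apply: eq_integral => x _; rewrite phi_tau.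
have nu_gt0 : 0 < nu setT by rewrite /nu /pushforward preimage_setT.
have [c c0 cP] := invariant_integral_unique nuD nu_gt0.
by exists c => // f mf f0; rewrite -cP// integral_nu.
Qed.

End transport.

(** The constant stands for [1 / |det f|]. Only its positivity matters for finiteness, so uniqueness
    of invariant measures replaces determinants. *)
Lemma integral_linear_bijection {R : realType} (V W : finHilbertType R)
    (f : 'Hom(V, W)) (g : 'Hom(W, V)) :
  cancel f g -> cancel g f ->
  exists2 c : R, 0 < c & forall h : borel W -> \bar R,
    measurable_fun setT h -> (forall x, 0 <= h x)%E ->
    (\int[lebesgue_hilbert V]_x h (f x) =
     c%:E * \int[lebesgue_hilbert W]_y h y)%E.
Proof.
move=> fK gK.
apply: (@integral_transport _ W _ (borel V) (lebesgue_hilbert V) (sigma_finiteT _) f g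
  (fun w x => (x : V) + g w)) => //.
- exact: measurable_hom.
- exact: measurable_hom.
- by move=> w x; rewrite /= linearD/= gK.
- by move=> w h mh h0; exact: ge0_integral_shift.
- exact: lebesgue_hilbert_gt0.
Qed.

(** A direct sum decomposition through injections and projections: the summands are spaces in their
    own right, each with its own Lebesgue measure. *)
Definition splitting {R : realType} (H V W : finHilbertType R)
    (i1 : 'Hom(V, H)) (i2 : 'Hom(W, H)) (r1 : 'Hom(H, V)) (r2 : 'Hom(H, W)) :=
  [/\ cancel i1 r1, cancel i2 r2, forall v, r2 (i1 v) = 0, forall w, r1 (i2 w) = 0 &
      forall x, i1 (r1 x) + i2 (r2 x) = x].

(* The canonical structure inferred for [mu \x nu] is the one for products of
   probability measures, which does not apply here. *)
Lemma sigma_finite_product {R : realType} d1 d2 (X : measurableType d1)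
    (Y : measurableType d2) (mu : {sigma_finite_measure set X -> \bar R})
    (nu : {sigma_finite_measure set Y -> \bar R}) :
  sigma_finite setT (mu \x nu)%E.
Proof.
have /sigma_finiteP[F [TF ndF Foo]] := sigma_finiteT mu.
have /sigma_finiteP[G [TG ndG Goo]] := sigma_finiteT nu.
exists (fun k => F k `*` G k).
  rewrite -setXTT TF TG predeqE => -[x y]; split; last first.
    by move=> [k _ [/= Fk Gk]]; split; exists k.
  move=> [/= [k _ Fk] [l _ Gl]]; exists (maxn k l) => //; split.
    by move: x Fk; exact/subsetPset/ndF/leq_maxl.
  by move: y Gl; exact/subsetPset/ndG/leq_maxr.
move=> k; have [mF Fk] := Foo k; have [mG Gk] := Goo k.
split; first exact: measurableX.
by rewrite product_measure1E// lte_mul_pinfty// ge0_fin_numE.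
Qed.

Lemma measurable_combine {R : realType} (H V W : finHilbertType R)
    (i1 : 'Hom(V, H)) (i2 : 'Hom(W, H)) :
  measurable_fun setT
    (fun z : (borel W * borel V)%type => i1 z.2 + i2 z.1 : borel H).
Proof.
apply: measurable_borelD.
  exact: (measurableT_comp (measurable_hom i1) measurable_snd).
exact: (measurableT_comp (measurable_hom i2) measurable_fst).
Qed.

(** Transport of the product measure along [(w, v) |-> i1 v + i2 w]. The inner products of [V] and
    [W] are not tied to that of [H], hence the constant [c]. *)
Lemma integral_splitting {R : realType} (H V W : finHilbertType R)
    (i1 : 'Hom(V, H)) (i2 : 'Hom(W, H)) (r1 : 'Hom(H, V)) (r2 : 'Hom(H, W)) :
  splitting i1 i2 r1 r2 ->
  exists2 c : R, 0 < c & forall h : borel H -> \bar R,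
    measurable_fun setT h -> (forall x, 0 <= h x)%E ->
    (\int[lebesgue_hilbert W]_w \int[lebesgue_hilbert V]_v h (i1 v + i2 w)%R =
     c%:E * \int[lebesgue_hilbert H]_x h x)%E.
Proof.
move=> [i1K i2K r2i1 r1i2 iE].
pose mu1 : {sigma_finite_measure set (borel W) -> \bar R} := lebesgue_hilbert W.
pose mu2 : {sigma_finite_measure set (borel V) -> \bar R} := lebesgue_hilbert V.
pose phi (z : (borel W * borel V)%type) : borel H := i1 z.2 + i2 z.1.
pose psi (x : borel H) : (borel W * borel V)%type := (r2 x, r1 x).
pose tau (x : H) (z : (borel W * borel V)%type) : (borel W * borel V)%type :=
  ((z.1 : W) + r2 x, (z.2 : V) + r1 x).
have mphi : measurable_fun setT phi by exact: measurable_combine.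
have mpsi : measurable_fun setT psi.
  by apply: measurable_fun_pair; exact: measurable_hom.
have phiK : cancel phi psi.
  by move=> [w v]; rewrite /psi /phi /= !linearD/= r2i1 add0r i2K i1K r1i2 addr0.
have phi_tau x z : phi (tau x z) = (phi z : H) + x.
  by rewrite /phi /tau /= !linearD/= addrACA iE.
have mu_tau x (h : (borel W * borel V)%type -> \bar R) : measurable_fun setT h ->
    (forall z, 0 <= h z)%E ->
    (\int[mu1 \x mu2]_z h (tau x z) = \int[mu1 \x mu2]_z h z)%E.
  move=> mh h0; have mtau : measurable_fun setT (tau x).
    apply: measurable_fun_pair.
      exact: (measurableT_comp (measurable_shift (r2 x)) measurable_fst).
    exact: (measurableT_comp (measurable_shift (r1 x)) measurable_snd).
  rewrite fubini_tonelli1//; last exact: (measurableT_comp mh mtau).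
  rewrite fubini_tonelli1//.
  have mF := measurable_fun_fubini_tonelli_F (m2 := mu2) h mh h0.
  rewrite -[RHS](@ge0_integral_shift _ _ (r2 x))//; last first.
    by move=> w; exact: integral_ge0.
  apply: eq_integral => w _; rewrite /fubini_F.
  rewrite -[RHS](@ge0_integral_shift _ _ (r1 x))//.
  exact: (measurableT_comp mh (pair1_measurable (w + r2 x : borel W))).
have mu_gt0 : (0 < (mu1 \x mu2) setT)%E.
  by rewrite -setXTT product_measure1E// mule_gt0//; exact: lebesgue_hilbert_gt0.
have [c c0 cP] := integral_transport (sigma_finite_product mu1 mu2)
  mphi mpsi phiK phi_tau mu_tau mu_gt0.
exists c => // h mh h0; rewrite -cP// fubini_tonelli1//.
exact: (measurableT_comp mh mphi).
Qed.

HB.instance Definition _ (R : realType) (V : finHilbertType R) (U : {vspace V}) :=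
  isFinHilbert.Build R (subvs_of U)
    (dotp := fun u v => dotp (vsval u) (vsval v))
    (fun u v => dotpC (vsval u) (vsval v))
    (fun v a u1 u2 => etrans (congr1 (fun x => dotp x (vsval v)) (linearP _ a u1 u2))
       (dotp_linear (vsval v) a (vsval u1) (vsval u2)))
    (fun v v0 => dotp_gt0 (vsval v) v0).

(** Kept as data rather than as an existence statement, so that the stretches used for necessity can
    be defined from its components. *)
Record subspace_splitting {R : realType} (H : finHilbertType R) (U : {vspace H}) :=
  SubspaceSplitting {
    spV : finHilbertType R; spW : finHilbertType R;
    spi1 : 'Hom(spV, H); spi2 : 'Hom(spW, H);
    spr1 : 'Hom(H, spV); spr2 : 'Hom(H, spW);
    spP : splitting spi1 spi2 spr1 spr2;
    spU : limg spi1 = U }.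

(** The summands are [U] and its algebraic complement [U^C], with restricted inner products; the
    projections are along one another. *)
Lemma split_subspace {R : realType} (H : finHilbertType R) (U : {vspace H}) :
  subspace_splitting U.
Proof.
have cap0 : (U :&: U^C = 0)%VS by exact: capv_compl.
have cap0' : (U^C :&: U = 0)%VS by rewrite capvC.
apply: (@SubspaceSplitting _ _ _ (subvs_of U) (subvs_of (U^C)%VS) (linfun vsval)
  (linfun vsval) (linfun (vsproj U) \o daddv_pi U U^C)%VF
  (linfun (vsproj U^C) \o daddv_pi U^C U)%VF); last first.
  apply/vspaceP => x; apply/memv_imgP/idP => [[u _ ->]|xU].
    by rewrite lfunE/= subvsP.
  by exists (Subvs xU); rewrite ?memvf// lfunE.
split.
- move=> v; rewrite comp_lfunE !lfunE/= daddv_pi_id ?subvsP//.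
  exact: vsvalK.
- move=> v; rewrite comp_lfunE !lfunE/= daddv_pi_id ?subvsP//.
  exact: vsvalK.
- move=> v; rewrite comp_lfunE !lfunE/=.
  suff -> : daddv_pi U^C U (vsval v) = 0 by rewrite linear0.
  apply: (addrI (daddv_pi U U^C (vsval v))).
  by rewrite addr0 daddv_pi_add// ?addv_complf ?memvf// daddv_pi_id// subvsP.
- move=> v; rewrite comp_lfunE !lfunE/=.
  suff -> : daddv_pi U U^C (vsval v) = 0 by rewrite linear0.
  apply: (addIr (daddv_pi U^C U (vsval v))).
  by rewrite add0r daddv_pi_add// ?addv_complf ?memvf// daddv_pi_id// subvsP.
- move=> x; rewrite !comp_lfunE !lfunE/= !vsprojK ?memv_pi//.
  by rewrite daddv_pi_add// addv_complf memvf.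
Qed.

(** * Hoelder's inequality for nonnegative extended functions *)

Section ereal_products.
Context {R : realType}.
Local Open Scope ereal_scope.

Lemma lee_prod (I : Type) (r : seq I) (P : pred I) (f g : I -> \bar R) :
    (forall i, P i -> 0 <= f i) -> (forall i, P i -> f i <= g i) ->
  \prod_(i <- r | P i) f i <= \prod_(i <- r | P i) g i.
Proof.
move=> f0 fg; suff : 0 <= \prod_(i <- r | P i) f i <= \prod_(i <- r | P i) g i.
  by move=> /andP[].
elim/big_ind2 : _ => [|x1 y1 x2 y2 /andP[x0 xy] /andP[x20 xy2]|i Pi].
- by rewrite lee01 lexx.
- by rewrite mule_ge0// lee_pmul.
- by rewrite f0// fg.
Qed.

Lemma poweR_prod (I : Type) (r : seq I) (P : pred I) (f : I -> \bar R) (s : R) :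
    (forall i, P i -> 0 <= f i) ->
  (\prod_(i <- r | P i) f i) `^ s = \prod_(i <- r | P i) (f i `^ s).
Proof.
move=> f0; elim: r => [|i r IH]; first by rewrite !big_nil poweR1r.
rewrite !big_cons; case: ifPn => // Pi.
by rewrite poweRM ?f0 ?prode_ge0// IH.
Qed.

Lemma poweRD_ge0 (x : \bar R) (r s : R) : (0 <= r)%R -> (0 <= s)%R ->
  x `^ (r + s) = x `^ r * x `^ s.
Proof.
move=> r0 s0; have [|rs] := eqVneq (r + s)%R 0%R.
  move=> /eqP; rewrite paddr_eq0// => /andP[/eqP-> /eqP->].
  by rewrite addr0 !poweRe0 mule1.
by rewrite poweRD// add_neq0_poweRD_def.
Qed.

Lemma lee_poweR (x y : \bar R) (r : R) : (0 <= r)%R -> 0 <= x -> x <= y ->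
  x `^ r <= y `^ r.
Proof.
move=> r0 x0 xy; apply: gt0_ler_poweR => //; rewrite in_itv/= ?leey ?x0//.
by rewrite (le_trans x0).
Qed.

Lemma emeasurable_prod d (T : measurableType d) (I : Type) (r : seq I)
    (P : pred I) (f : I -> T -> \bar R) :
    (forall i, measurable_fun setT (f i)) ->
  measurable_fun setT (fun x => \prod_(i <- r | P i) f i x).
Proof.
move=> mf; elim: r => [|i r IH].
  rewrite [X in measurable_fun _ X](_ : _ = cst 1)//.
  by apply/funext => x; rewrite big_nil.
rewrite [X in measurable_fun _ X](_ : _ = fun x =>
    if P i then f i x * \prod_(j <- r | P j) f j x else \prod_(j <- r | P j) f j x).
  by case: (P i) => //; exact: emeasurable_funM.
by apply/funext => x; rewrite big_cons.
Qed.

(** Young's inequality for [x ^ t] and [y ^ (1 - t)] with conjugate exponents [1 / t] and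
    [1 / (1 - t)]. *)
Lemma weighted_AMGM (x y t : R) : (0 <= x)%R -> (0 <= y)%R -> (0 < t < 1)%R ->
  (x `^ t * y `^ (1 - t) <= t * x + (1 - t) * y)%R.
Proof.
move=> x0 y0 /andP[t0 t1]; have t10 : (0 < 1 - t)%R by rewrite subr_gt0.
have := @conjugate_powR _ (x `^ t)%R (y `^ (1 - t))%R t^-1%R (1 - t)^-1%R.
rewrite !powR_ge0 !invr_gt0 !invrK => /(_ isT isT t0 t10).
rewrite subrKC -!powRrM !mulfV ?gt_eqF// !powRr1// => /(_ erefl).
by rewrite (mulrC t) (mulrC (1 - t)%R).
Qed.

Context d (T : measurableType d) (mu : {measure set T -> \bar R}).

Lemma measurable_funT_poweR (f : T -> \bar R) (s : R) :
  measurable_fun setT f -> measurable_fun setT (fun x => f x `^ s).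
Proof. by move=> mf; exact: (measurableT_comp (measurable_poweR s) mf). Qed.

(** [F] vanishes almost everywhere, and [0 * +oo = 0] makes the product vanish there even where [G]
    is infinite. This settles the degenerate case of Hoelder's inequality. *)
Lemma ge0_integral_poweRM_eq0 (F G : T -> \bar R) (t : R) :
    measurable_fun setT F -> (forall x, 0 <= F x) ->
    measurable_fun setT G -> (forall x, 0 <= G x) -> (0 < t)%R ->
  \int[mu]_x F x = 0 -> \int[mu]_x (F x `^ t * G x) = 0.
Proof.
move=> mF F0 mG G0 t0 IF; rewrite -[RHS](integral0 mu setT).
apply: ge0_ae_eq_integral => //.
- by apply: emeasurable_funM => //; exact: measurable_funT_poweR.
- by move=> x _; rewrite mule_ge0// poweR_ge0.
have /(ae_eq_integral_abs mu measurableT mF) : \int[mu]_x `|F x| = 0.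
  by under eq_integral do rewrite gee0_abs//.
by apply: filterS => x /(_ I) -> _; rewrite poweR0r ?mul0e// gt_eqF.
Qed.

(** Once vanishing and infinite integrals are set aside, weighted AM-GM is applied to [F] and [G]
    divided by their integrals, and integrated. *)
Lemma ge0_hoelder (F G : T -> \bar R) (t : R) :
    measurable_fun setT F -> (forall x, 0 <= F x) ->
    measurable_fun setT G -> (forall x, 0 <= G x) -> (0 < t < 1)%R ->
  \int[mu]_x (F x `^ t * G x `^ (1 - t)) <=
  (\int[mu]_x F x) `^ t * (\int[mu]_x G x) `^ (1 - t).
Proof.
move=> mF F0 mG G0 /andP[t0 t1].
have t10 : (0 < 1 - t)%R by rewrite subr_gt0.
have IF0 : 0 <= \int[mu]_x F x by exact: integral_ge0.
have IG0 : 0 <= \int[mu]_x G x by exact: integral_ge0.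
have [F_eq0|F_neq0] := eqVneq (\int[mu]_x F x) 0.
  rewrite (ge0_integral_poweRM_eq0 mF F0 _ _ t0 F_eq0); last 2 first.
  - exact: measurable_funT_poweR.
  - by move=> x; exact: poweR_ge0.
  by rewrite mule_ge0// poweR_ge0.
have [G_eq0|G_neq0] := eqVneq (\int[mu]_x G x) 0.
  under eq_integral do rewrite muleC.
  rewrite (ge0_integral_poweRM_eq0 mG G0 _ _ t10 G_eq0); last 2 first.
  - exact: measurable_funT_poweR.
  - by move=> x; exact: poweR_ge0.
  by rewrite mule_ge0// poweR_ge0.
have F_gt0 : 0 < \int[mu]_x F x by rewrite lt0e F_neq0.
have G_gt0 : 0 < \int[mu]_x G x by rewrite lt0e G_neq0.
have [Fy|Fy] := eqVneq (\int[mu]_x F x) +oo.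
  by rewrite Fy poweRyr ?gt_eqF// gt0_mulye ?leey// poweR_gt0.
have [Gy|Gy] := eqVneq (\int[mu]_x G x) +oo.
  by rewrite Gy poweRyr ?gt_eqF// gt0_muley ?leey// poweR_gt0.
have : \int[mu]_x F x \is a fin_num by rewrite ge0_fin_numE// ltey.
have : \int[mu]_x G x \is a fin_num by rewrite ge0_fin_numE// ltey.
case GE : (\int[mu]_x G x) G_gt0 => [b| |]// b0 _; rewrite lte_fin in b0.
case FE : (\int[mu]_x F x) F_gt0 => [a| |]// a0 _; rewrite lte_fin in a0.
(* [k] is the right-hand side. AM-GM for [F / a] and [G / b], multiplied by [k], has coefficients
   [k * t / a] and [k * (1 - t) / b]; the bound integrates to [k * t + k * (1 - t) = k]. *)
pose k := (a `^ t * b `^ (1 - t))%R.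
have k0 : (0 < k)%R by rewrite mulr_gt0// powR_gt0.
have c1 : (0 < k * t / a)%R by rewrite divr_gt0// mulr_gt0.
have c2 : (0 < k * (1 - t) / b)%R by rewrite divr_gt0// mulr_gt0.
apply: (@le_trans _ _ (\int[mu]_x ((k * t / a)%:E * F x + (k * (1 - t) / b)%:E * G x))).
  apply: ge0_le_integral => //.
  - by move=> x _; rewrite mule_ge0// poweR_ge0.
  - by apply: emeasurable_funM; exact: measurable_funT_poweR.
  - by apply: emeasurable_funD; exact: measurable_funeM.
  move=> x _; move: (F0 x) (G0 x).
  case: (F x) => [u| |]// u0; last first.
    move=> v0; rewrite gt0_muley ?lte_fin// addye ?leey//.
    by rewrite gt_eqF// (lt_le_trans (ltNyr 0%R))// mule_ge0// lee_fin ltW.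
  case: (G x) => [v| |]// v0; last by rewrite gt0_muley ?lte_fin// leey.
  rewrite !poweR_EFin -!EFinM -EFinD lee_fin; rewrite !lee_fin in u0 v0.
  have -> : (k * t / a * u + k * (1 - t) / b * v =
     k * (t * (u / a) + (1 - t) * (v / b)))%R by ring.
  have -> : (u `^ t * v `^ (1 - t) = k * ((u / a) `^ t * (v / b) `^ (1 - t)))%R.
    rewrite /k mulrACA -!powRM ?divr_ge0 ?(ltW a0) ?(ltW b0)//.
    by rewrite ![(_ * (_ / _))%R]mulrC !divfK ?gt_eqF.
  by rewrite ler_pM2l// weighted_AMGM ?t0// divr_ge0// ltW.
rewrite ge0_integralD//; last 4 first.
- by move=> x _; rewrite mule_ge0// lee_fin ltW.
- exact: measurable_funeM.
- by move=> x _; rewrite mule_ge0// lee_fin ltW.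
- exact: measurable_funeM.
rewrite !ge0_integralZl_EFin ?(ltW c1) ?(ltW c2)// FE GE -!EFinM -EFinD lee_fin.
rewrite !divfK ?gt_eqF// -mulrDr addrC subrK mulr1.
by rewrite /k.
Qed.

End ereal_products.

(** * Finiteness of Brascamp-Lieb constants *)

(* Since [x `^ 0 = 1], exponent 0 removes the corresponding factor altogether. *)
Definition BL_finite {R : realType} (H : finHilbertType R) (J : finType)
    (K : J -> finHilbertType R) (B : forall j, 'Hom(H, K j)) (s : J -> R) : Prop :=
  exists2 C : R, 0 < C & forall g : forall j, borel (K j) -> \bar R,
    (forall j, measurable_fun setT (g j)) -> (forall j y, 0 <= g j y)%E ->
    (\int[lebesgue_hilbert H]_x \prod_j (g j (B j x) `^ s j) <=
     C%:E * \prod_j ((\int[lebesgue_hilbert (K j)]_y g j y) `^ s j))%E.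

Section BL_finite_theory.
Context {R : realType} (H : finHilbertType R) (J : finType).
Context (K : J -> finHilbertType R) (B : forall j, 'Hom(H, K j)).
Local Open Scope ereal_scope.

Lemma measurable_BL_integrand (g : forall j, borel (K j) -> \bar R) (s : J -> R) :
    (forall j, measurable_fun setT (g j)) ->
  measurable_fun setT (fun x : borel H => \prod_j (g j (B j x) `^ s j)).
Proof.
move=> mg; apply: (@emeasurable_prod _ _ _ _ _ _
  (fun j (x : borel H) => g j (B j x) `^ s j)) => j.
apply: (@measurable_funT_poweR _ _ _ (fun x : borel H => g j (B j x))).
exact: (measurableT_comp (mg j) (measurable_hom (B j))).
Qed.

(** The integrand for the combined exponents is the product of the two integrands to the powers [t]
    and [1 - t], so Hoelder's inequality applies. *)
Lemma BL_finite_convex (s1 s2 : J -> R) (t : R) : (0 < t < 1)%R ->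
    (forall j, 0 <= s1 j)%R -> (forall j, 0 <= s2 j)%R ->
  BL_finite B s1 -> BL_finite B s2 ->
  BL_finite B (fun j => t * s1 j + (1 - t) * s2 j)%R.
Proof.
move=> t01 s10 s20 [C1 C10 BL1] [C2 C20 BL2].
have /andP[t0 t1] := t01; have t10 : (0 < 1 - t)%R by rewrite subr_gt0.
exists (C1 `^ t * C2 `^ (1 - t))%R => [|g mg g0]; first by rewrite mulr_gt0// powR_gt0.
have splitE (x : forall j, \bar R) : (forall j, 0 <= x j) ->
    \prod_j (x j `^ (t * s1 j + (1 - t) * s2 j)) =
    (\prod_j (x j `^ s1 j)) `^ t * (\prod_j (x j `^ s2 j)) `^ (1 - t).
  move=> x0; rewrite !poweR_prod; try by move=> *; exact: poweR_ge0.
  rewrite -big_split; apply: eq_bigr => j _ /=; rewrite -!poweRrM -poweRD_ge0.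
  - by rewrite [(s1 j * _)%R]mulrC [(s2 j * _)%R]mulrC.
  - by rewrite mulr_ge0// ltW.
  - by rewrite mulr_ge0// ltW.
under eq_integral do rewrite splitE//.
have pr0 (s : J -> R) (x : forall j, \bar R) : 0 <= \prod_j (x j `^ s j).
  by apply: prode_ge0 => j _; exact: poweR_ge0.
pose F s (x : borel H) := \prod_j (g j (B j x) `^ s j).
apply: (@le_trans _ _ ((\int[lebesgue_hilbert H]_x F s1 x) `^ t *
    (\int[lebesgue_hilbert H]_x F s2 x) `^ (1 - t))).
  apply: (@ge0_hoelder _ _ _ (lebesgue_hilbert H) (F s1) (F s2) t) => //.
  - exact: measurable_BL_integrand.
  - by move=> x; exact: pr0.
  - exact: measurable_BL_integrand.
  - by move=> x; exact: pr0.
rewrite splitE => [|j]; last exact: integral_ge0.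
rewrite EFinM muleACA -!poweR_EFin -!poweRM ?pr0// ?lee_fin ?(ltW C10) ?(ltW C20)//.
rewrite lee_pmul ?poweR_ge0//; apply: lee_poweR; rewrite ?(ltW t0) ?(ltW t10)//.
- by apply: integral_ge0 => x _; exact: (pr0 s1).
- exact: BL1.
- by apply: integral_ge0 => x _; exact: (pr0 s2).
- exact: BL2.
Qed.

(** With exponent 0 both sides are 1. A space of dimension 0 is a point of mass 1, so the integral
    is the value of [g]. Such targets arise when critical subspaces are split off. *)
Lemma BL_trivial_factor (j : J) (s : R) :
    s = 0%R \/ \dim {: K j} = 0%N ->
  exists2 C : R, (0 < C)%R & forall g : borel (K j) -> \bar R,
    measurable_fun setT g -> (forall y, 0 <= g y) -> forall x : H,
    g (B j x) `^ s <= C%:E * (\int[lebesgue_hilbert (K j)]_y g y) `^ s.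
Proof.
move=> [->|dK]; first by exists 1%R => // g mg g0 x; rewrite !poweRe0 mule1.
have K0 (y : K j) : y = 0%R.
  apply/eqP; rewrite -memv0; suff -> : 0%VS = {: K j}%VS by exact: memvf.
  by apply/esym/eqP; rewrite -dimv_eq0 dK.
pose m := lebesgue_hilbert (K j) setT.
have m1 : m = 1.
  have := @lebesgue_hilbert_box _ (K j) 1%R ltr01; rewrite dK expr0 => <-.
  congr (lebesgue_hilbert (K j) _); apply/seteqP; split => // y _ k.
  by have : (k < 0)%N by rewrite -dK.
exists 1%R => // g mg g0 x; rewrite mul1e (_ : \int[_]_y g y = g (B j x))//.
rewrite -[RHS]mule1 -m1 -integral_cst//; apply: eq_integral => y _ /=.
by rewrite (K0 y) (K0 (B j x)).
Qed.

Lemma BL_finite_trivial (s : J -> R) : \dim {: H} = 0%N ->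
    (forall j, s j = 0%R \/ \dim {: K j} = 0%N) ->
  BL_finite B s.
Proof.
move=> dH sK; have /choice[C CP] j : exists C : R, (0 < C)%R /\
    forall g : borel (K j) -> \bar R,
    measurable_fun setT g -> (forall y, 0 <= g y) -> forall x : H,
    g (B j x) `^ s j <= C%:E * (\int[lebesgue_hilbert (K j)]_y g y) `^ s j.
  by have [C C0 CP] := BL_trivial_factor (sK j); exists C.
have m1 : lebesgue_hilbert H setT = 1.
  have := @lebesgue_hilbert_box _ H 1%R ltr01; rewrite dH expr0 => <-.
  congr (lebesgue_hilbert H _); apply/seteqP; split => // y _ k.
  by have : (k < 0)%N by rewrite -dH.
exists (\prod_j C j)%R => [|g mg g0]; first by apply: prodr_gt0 => j _; have [] := CP j.
rewrite -prodEFin -big_split/=; set M := (X in _ <= X).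
have <- : \int[lebesgue_hilbert H]_x cst M x = M.
  by rewrite integral_cst//= m1 mule1.
apply: ge0_le_integral => //.
- by move=> x _; apply: prode_ge0 => j _; exact: poweR_ge0.
- exact: measurable_BL_integrand.
- move=> x _; apply: lee_prod => j _; first exact: poweR_ge0.
  by have [_] := CP j; exact.
Qed.

(** The factor of [j0] is integrated by a linear change of variables; every other factor is bounded
    pointwise by [BL_trivial_factor]. *)
Lemma BL_finite_bijective (s : J -> R) (j0 : J) :
    s j0 = 1%R -> \dim {: H} = \dim {: K j0} -> limg (B j0) = {: K j0}%VS ->
    (forall j, j != j0 -> s j = 0%R \/ \dim {: K j} = 0%N) ->
  BL_finite B s.
Proof.
move=> sj0 dHK B0surj sK.
have ker0 : lker (B j0) = 0%VS.
  have := limg_ker_dim (B j0) {: H}; rewrite B0surj dHK capfv => /eqP.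
  by rewrite -[X in _ == X]add0n eqn_add2r dimv_eq0 => /eqP.
have BK : cancel (B j0) (B j0)^-1%VF by apply: lker0_lfunK; rewrite ker0.
have BVK : cancel (B j0)^-1%VF (B j0).
  by move=> y; apply: limg_lfunVK; rewrite B0surj memvf.
have [c c0 cP] := integral_linear_bijection BK BVK.
have /choice[C CP] j : exists C : R, (0 < C)%R /\ (j != j0 ->
    forall g : borel (K j) -> \bar R,
    measurable_fun setT g -> (forall y, 0 <= g y) -> forall x : H,
    g (B j x) `^ s j <= C%:E * (\int[lebesgue_hilbert (K j)]_y g y) `^ s j).
  have [->|jj0] := eqVneq j j0; first by exists 1%R.
  by have [C C0 CP] := BL_trivial_factor (sK j jj0); exists C.
have C0 j : (0 < C j)%R by have [] := CP j.
exists (c * \prod_(j | j != j0) C j)%R => [|g mg g0].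
  by rewrite mulr_gt0// prodr_gt0.
pose k := \prod_(j | j != j0) ((C j)%:E * (\int[lebesgue_hilbert (K j)]_y g j y) `^ s j).
have k0 : 0 <= k.
  by apply: prode_ge0 => j _; rewrite mule_ge0 ?poweR_ge0// lee_fin ltW.
rewrite [X in _ <= _ * X](bigD1 j0)//= sj0 poweRe1 ?integral_ge0//.
rewrite EFinM muleACA -prodEFin -big_split/= -/k -cP// -ge0_integralZr//; last first.
  exact: (measurableT_comp (mg j0) (measurable_hom (B j0))).
apply: ge0_le_integral => //.
- by move=> x _; apply: prode_ge0 => j _; exact: poweR_ge0.
- exact: measurable_BL_integrand.
- apply: emeasurable_funM => //.
  exact: (measurableT_comp (mg j0) (measurable_hom (B j0))).
move=> x _; rewrite (bigD1 j0)//= sj0 poweRe1//.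
rewrite lee_wpmul2l//; apply: lee_prod => j jj0; first exact: poweR_ge0.
by have [_] := CP j; exact.
Qed.

End BL_finite_theory.

Section BL_finite_split.
Local Open Scope ereal_scope.

(* Fubini over [V] and a complement [W]: the inner integral is controlled on
   [V], with constants that do not depend on the point of [W] because the
   integrals over the targets are translation invariant. *)
Lemma BL_finite_split {R : realType} (H V W : finHilbertType R) (J : finType)
    (K : J -> finHilbertType R) (B : forall j, 'Hom(H, K j)) (K1 K2 : J -> finHilbertType R)
    (i1 : 'Hom(V, H)) (i2 : 'Hom(W, H)) (r1 : 'Hom(H, V)) (r2 : 'Hom(H, W))
    (k1 : forall j, 'Hom(K1 j, K j)) (k2 : forall j, 'Hom(K2 j, K j))
    (q1 : forall j, 'Hom(K j, K1 j)) (q2 : forall j, 'Hom(K j, K2 j))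
    (s : J -> R) :
    splitting i1 i2 r1 r2 -> (forall j, splitting (k1 j) (k2 j) (q1 j) (q2 j)) ->
    (forall j v, q2 j (B j (i1 v)) = 0%R) -> (forall j, 0 <= s j)%R ->
  BL_finite (fun j => q1 j \o (B j \o i1))%VF s ->
  BL_finite (fun j => q2 j \o (B j \o i2))%VF s ->
  BL_finite B s.
Proof.
move=> spH spK qBi s0 [C1 C10 BL1] [C2 C20 BL2].
have [c c0 cP] := integral_splitting spH.
have /choice[e eP] j : exists e : R, (0 < e)%R /\
    forall h : borel (K j) -> \bar R,
    measurable_fun setT h -> (forall x, 0 <= h x)%E ->
    \int[lebesgue_hilbert (K2 j)]_w \int[lebesgue_hilbert (K1 j)]_v h (k1 j v + k2 j w)%R =
     e%:E * \int[lebesgue_hilbert (K j)]_x h x.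
  by have [e e0 eP] := integral_splitting (spK j); exists e.
pose E := (\prod_j (e j `^ s j))%R.
have E0 : (0 < E)%R by apply: prodr_gt0 => j _; apply: powR_gt0; have [] := eP j.
exists (c^-1 * (C1 * C2 * E))%R => [|g mg g0].
  by rewrite mulr_gt0 ?invr_gt0// !mulr_gt0.
(* Multiplied by [c], the left side becomes the iterated integral over [W] and [V]. *)
rewrite EFinM -muleA -(@lee_pmul2l _ c%:E)// muleA -EFinM divff ?gt_eqF// mul1e.
pose F (x : borel H) := \prod_j (g j (B j x) `^ s j).
have mF : measurable_fun setT F by exact: measurable_BL_integrand.
have F0 x : 0 <= F x by apply: prode_ge0 => j _; exact: poweR_ge0.
rewrite -(cP F)//.
have mk j : measurable_fun setT (fun z : borel (K2 j) * borel (K1 j) =>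
    g j (k1 j z.2 + k2 j z.1)%R).
  exact: (measurableT_comp (mg j) (measurable_combine (k1 j) (k2 j))).
pose G j (z : borel (K2 j)) := \int[lebesgue_hilbert (K1 j)]_u g j (k1 j u + k2 j z)%R.
have mG j : measurable_fun setT (G j).
  have := measurable_fun_fubini_tonelli_F (m2 := lebesgue_hilbert (K1 j))
    (fun z : borel (K2 j) * borel (K1 j) => g j (k1 j z.2 + k2 j z.1)%R) (mk j).
  by apply.
have G0 j z : 0 <= G j z by exact: integral_ge0.
(* By [qBi], [B j] is block triangular. For fixed [w] the off-diagonal block [q1 j (B j (i2 w))] is
   a translation in [K1 j], which leaves integrals over [K1 j] unchanged. *)
have BE j v w : (B j (i1 v + i2 w) = k1 j ((q1 j \o (B j \o i1))%VF v + q1 j (B j (i2 w)))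
    + k2 j ((q2 j \o (B j \o i2))%VF w))%R.
  have [_ _ _ _ kE] := spK j.
  by rewrite -[LHS]kE !linearD/= qBi linear0 add0r !comp_lfunE/=.
apply: (@le_trans _ _ (\int[lebesgue_hilbert W]_w (C1%:E *
    \prod_j (G j ((q2 j \o (B j \o i2))%VF w) `^ s j)))).
  apply: ge0_le_integral => //.
  - move=> w _; apply: integral_ge0 => v _.
    by apply: prode_ge0 => j _; exact: poweR_ge0.
  - have := measurable_fun_fubini_tonelli_F (m2 := lebesgue_hilbert V)
      (fun z : borel W * borel V => F (i1 z.2 + i2 z.1)%R)
      (measurableT_comp mF (measurable_combine i1 i2)).
    by apply => z; exact: F0.
  - apply: measurable_funeM.
    exact: (@measurable_BL_integrand _ _ _ _ (fun j => q2 j \o (B j \o i2))%VF).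
  move=> w _; rewrite /F; under eq_integral do under eq_bigr do rewrite BE.
  pose gw j (u : borel (K1 j)) :=
    g j (k1 j (u + q1 j (B j (i2 w))) + k2 j ((q2 j \o (B j \o i2))%VF w))%R.
  have mgw j : measurable_fun setT (gw j).
    apply: (measurableT_comp (mg j)); apply: measurable_borelD => //.
    exact: (measurableT_comp (measurable_hom (k1 j)) (measurable_shift _)).
  have := BL1 gw mgw (fun j y => g0 j _).
  congr (_ <= _ * _); apply: eq_bigr => j _; congr (_ `^ _).
  apply: (@ge0_integral_shift _ (K1 j) (q1 j (B j (i2 w)))
    (fun u => g j (k1 j u + k2 j ((q2 j \o (B j \o i2))%VF w))%R)) => //.
  apply: (measurableT_comp (mg j)); apply: measurable_borelD => //.
  exact: measurable_hom.
rewrite ge0_integralZl_EFin//; last 3 first.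
- by move=> w _; apply: prode_ge0 => j _; exact: poweR_ge0.
- exact: (@measurable_BL_integrand _ _ _ _ (fun j => q2 j \o (B j \o i2))%VF).
- exact: ltW.
(* The second inequality is applied to the fibre integrals [G j], whose integrals over [K2 j] are
   [e j] times those of [g j]. *)
have := BL2 G mG G0; rewrite -(@lee_pmul2l _ C1%:E)// => /le_trans; apply.
rewrite !EFinM -!muleA.
apply: lee_wpmul2l; first by rewrite lee_fin ltW.
apply: lee_wpmul2l; first by rewrite lee_fin ltW.
rewrite /E -prodEFin -big_split/=; apply: lee_prod => j _; first exact: poweR_ge0.
have [e0 ejP] := eP j.
by rewrite ejP// poweRM ?integral_ge0// lee_fin ltW.
Qed.

End BL_finite_split.

Section splitting_dimensions.
Context {R : realType} (H V W : finHilbertType R).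
Variables (i1 : 'Hom(V, H)) (i2 : 'Hom(W, H)) (r1 : 'Hom(H, V)) (r2 : 'Hom(H, W)).
Hypothesis sp : splitting i1 i2 r1 r2.

Lemma dim_splitting_inl (A : {vspace V}) : \dim (i1 @: A) = \dim A.
Proof.
have [i1K _ _ _ _] := sp; apply: limg_dim_eq.
have /eqP -> : lker i1 == 0%VS by apply/lker0P; exact: can_inj i1K.
by rewrite capv0.
Qed.

Lemma lker_splitting : lker r2 = limg i1.
Proof.
have [_ _ r2i1 _ iE] := sp; apply/vspaceP => x; rewrite memv_ker.
apply/eqP/memv_imgP => [x0|[v _ ->]]; last exact: r2i1.
by exists (r1 x); rewrite ?memvf// -[LHS]iE x0 linear0 addr0.
Qed.

Lemma limg_splitting_inlK : (r1 @: limg i1 = fullv)%VS.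
Proof.
have [i1K _ _ _ _] := sp; apply/vspaceP => v; rewrite memvf; apply/memv_imgP.
by exists (i1 v); rewrite ?i1K// memv_img// memvf.
Qed.

Lemma limg_splitting_inrK (A : {vspace W}) : (r2 @: (i2 @: A) = A)%VS.
Proof.
have [_ i2K _ _ _] := sp; rewrite -limg_comp.
rewrite (_ : (r2 \o i2)%VF = \1%VF) ?lim1g//.
by apply/lfunP => w; rewrite comp_lfunE id_lfunE i2K.
Qed.

Lemma dim_splitting (X : {vspace H}) : (limg i1 <= X)%VS ->
  \dim X = (\dim (limg i1) + \dim (r2 @: X))%N.
Proof.
by move=> iX; rewrite -(limg_ker_dim r2 X) lker_splitting (capv_idPr iX).
Qed.

Lemma dim_splitting_inlK (X : {vspace H}) : (X <= limg i1)%VS ->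
  \dim (r1 @: X) = \dim X.
Proof.
have [i1K _ _ _ _] := sp => Xi; apply: limg_dim_eq; apply/eqP; rewrite -subv0.
apply/subvP => x /memv_capP[/(subvP Xi)/memv_imgP[v _ ->]].
by rewrite memv_ker i1K => /eqP ->; rewrite linear0 mem0v.
Qed.

Lemma splitting_full : (limg i1 + limg i2 = fullv)%VS.
Proof.
have [_ _ _ _ iE] := sp; apply/vspaceP => x; rewrite memvf -[x]iE.
by rewrite memv_add// memv_img// memvf.
Qed.

End splitting_dimensions.

(** * Critical subspaces and the motion of exponents *)

Section BL_condition.
Context {R : realType} (J : finType).

(** A subspace of slack 0 is critical. The slack is affine in [s], hence easy to follow when
    exponents move along a line. *)
Definition BL_slack (H : finHilbertType R) (K : J -> finHilbertType R)
    (B : forall j, 'Hom(H, K j)) (s : J -> R) (V : {vspace H}) : R :=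
  \sum_j s j * (\dim (B j @: V))%:R - (\dim V)%:R.

Definition BL_condition (H : finHilbertType R) (K : J -> finHilbertType R)
    (B : forall j, 'Hom(H, K j)) (s : J -> R) : Prop :=
  BL_slack B s fullv = 0 /\ forall V : {vspace H}, 0 <= BL_slack B s V.

(** A critical [U] splits the datum into its restriction to [U], with targets [B j @: U], and a
    quotient datum on [H / U]. Subspaces of [U] keep their slack; a subspace of the quotient has the
    slack of its preimage in [H] minus that of [U], which is 0. Both parts inherit the condition in
    smaller dimension. *)
Lemma BL_condition_critical (s : J -> R) (H : finHilbertType R)
    (K : J -> finHilbertType R) (B : forall j, 'Hom(H, K j)) (U : {vspace H}) :
    (forall j, 0 <= s j <= 1) -> (forall j, limg (B j) = fullv) ->
    BL_condition B s -> BL_slack B s U = 0 -> (0 < \dim U < \dim {: H})%N ->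
    (forall (H' : finHilbertType R) (K' : J -> finHilbertType R)
      (B' : forall j, 'Hom(H', K' j)), (\dim {: H'} < \dim {: H})%N ->
      (forall j, limg (B' j) = fullv) -> BL_condition B' s -> BL_finite B' s) ->
  BL_finite B s.
Proof.
move=> s01 Bsurj [Bfull BV] Ucrit /andP[U0 UH] IH.
have [V W i1 i2 r1 r2 sp iU] := split_subspace U.
pose D j := split_subspace (B j @: U).
have spK j := spP (D j).
have kU j : limg (spi1 (D j)) = (B j @: U)%VS := spU (D j).
have dV (A : {vspace V}) : \dim (i1 @: A) = \dim A := dim_splitting_inl sp A.
have dimV : \dim {: V} = \dim U by rewrite -dV iU.
have dimK1 j : \dim {: spV (D j)} = \dim (B j @: U).
  by rewrite -(dim_splitting_inl (spK j)) kU.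
have kerq j : lker (spr2 (D j)) = (B j @: U)%VS.
  by rewrite (lker_splitting (spK j)).
have q2B j : (spr2 (D j) @: (B j @: U) = 0)%VS.
  by apply/eqP; rewrite -lkerE kerq subvv.
have dB1 j (A : {vspace V}) :
    \dim ((spr1 (D j) \o (B j \o i1))%VF @: A) = \dim (B j @: (i1 @: A)).
  rewrite !limg_comp (dim_splitting_inlK (spK j))// kU.
  by rewrite limgS// -iU limgS// subvf.
have dB2 j (A : {vspace W}) : \dim (B j @: (U + i2 @: A)) =
    (\dim (B j @: U) + \dim ((spr2 (D j) \o (B j \o i2))%VF @: A))%N.
  rewrite limgD (dim_splitting (spK j)) ?kU ?addvSl//.
  by rewrite limgD q2B add0v !limg_comp.
have dW (A : {vspace W}) : \dim (U + i2 @: A) = (\dim U + \dim A)%N.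
  rewrite (dim_splitting sp) ?iU ?addvSl// limgD (limg_splitting_inrK sp).
  rewrite -{2}iU -(lker_splitting sp) (_ : (r2 @: lker r2 = 0)%VS) ?add0v//.
  by apply/eqP; rewrite -lkerE subvv.
have slack1 A : BL_slack (fun j => spr1 (D j) \o (B j \o i1))%VF s A =
    BL_slack B s (i1 @: A)%VS.
  by rewrite /BL_slack dV; congr (_ - _); apply: eq_bigr => j _; rewrite dB1.
have slack2 A : BL_slack (fun j => spr2 (D j) \o (B j \o i2))%VF s A =
    BL_slack B s (U + i2 @: A)%VS.
  rewrite -[LHS]add0r -Ucrit /BL_slack dW natrD opprD addrACA; congr (_ + _).
  by rewrite -big_split; apply: eq_bigr => j _; rewrite dB2 natrD mulrDr.
have UfullE : (U + limg i2)%VS = fullv by rewrite -iU (splitting_full sp).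
apply: (BL_finite_split sp spK).
- move=> j v; apply/eqP; rewrite -memv0 -(q2B j); apply: memv_img; apply: memv_img.
  by rewrite -iU memv_img// memvf.
- by move=> j; have /andP[] := s01 j.
- apply: IH => [|j|]; first by rewrite dimV.
    by rewrite !limg_comp iU -[RHS](limg_splitting_inlK (spK j)) kU.
  split=> [|A]; first by rewrite slack1 iU.
  by rewrite slack1.
- apply: IH => [|j|].
  + have := dW fullv; rewrite UfullE => ->.
    by rewrite -[ltnLHS]add0n ltn_add2r.
  + have q2full : (spr2 (D j) @: fullv)%VS = fullv.
      have := addvf (spr2 (D j) @: limg (spi1 (D j)))%VS.
      by rewrite -{1}(limg_splitting_inrK (spK j) fullv) -limgD (splitting_full (spK j)).
    by rewrite !limg_comp -[LHS]add0v -(q2B j) -!limgD UfullE Bsurj.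
  split=> [|A]; first by rewrite slack2 UfullE.
  by rewrite slack2.
Qed.

End BL_condition.

(** Stop at the smallest root [a i / - b i] among the decreasing functions: by then no function has
    become negative. *)
Lemma first_zero_affine (R : realFieldType) (I : finType) (a b : I -> R) :
    (forall i, 0 < a i) -> (exists i, b i < 0) ->
  exists2 t, 0 < t & (forall i, 0 <= a i + t * b i) /\ exists i, a i + t * b i = 0.
Proof.
move=> a0 [i0 bi0].
case: (@arg_minP _ _ _ i0 (fun i => b i < 0) (fun i => a i / - b i) bi0) => i bi imin.
exists (a i / - b i); first by rewrite divr_gt0// oppr_gt0.
split=> [k|]; last by exists i; field; rewrite lt_eqF.
have [bk|bk] := ltP (b k) 0; last first.
  by rewrite addr_ge0 ?(ltW (a0 k))// mulr_ge0// divr_ge0// ?oppr_ge0 ltW.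
have := imin k bk; rewrite ler_pdivlMr ?oppr_gt0//; lra.
Qed.

Lemma dim_limg_le (F : fieldType) (aT rT : vectType F) (f : 'Hom(aT, rT)) (U : {vspace aT}) :
  (\dim (f @: U) <= \dim U)%N.
Proof. by rewrite -(limg_ker_dim f U) leq_addl. Qed.

Section BL_condition_finite.
Context {R : realType} (J : finType).

(** The size of this set is the inner induction measure. Targets of dimension 0 are left out because
    their exponents do not affect any slack. *)
Definition fractional (K : J -> finHilbertType R) (s : J -> R) : {set J} :=
  [set j | (0 < s j < 1) && (0 < \dim {: K j})%N].

Section motion.
Variables (H : finHilbertType R) (K : J -> finHilbertType R).
Variables (B : forall j, 'Hom(H, K j)) (s : J -> R) (j0 j1 : J).
Hypothesis B_surj : forall j, limg (B j) = fullv.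
Hypothesis s01 : forall j, 0 <= s j <= 1.
Hypothesis s_cond : BL_condition B s.
Hypothesis no_critical : forall V : {vspace H}, (0 < \dim V < \dim {: H})%N ->
  0 < BL_slack B s V.
Hypotheses (j01 : j0 != j1) (fj0 : j0 \in fractional K s) (fj1 : j1 \in fractional K s).

(* The direction of motion keeps [\sum_j s j * \dim {: K j}] constant. *)
Definition moved (t : R) (j : J) : R :=
  s j + t * ((j == j0)%:R / (\dim {: K j0})%:R - (j == j1)%:R / (\dim {: K j1})%:R).

Let d0 : 0 < (\dim {: K j0})%:R :> R.
Proof. by move: fj0; rewrite inE ltr0n => /andP[]. Qed.

Let d1 : 0 < (\dim {: K j1})%:R :> R.
Proof. by move: fj1; rewrite inE ltr0n => /andP[]. Qed.

Lemma moved_slack t V : BL_slack B (moved t) V = BL_slack B s V +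
  t * ((\dim (B j0 @: V))%:R / (\dim {: K j0})%:R - (\dim (B j1 @: V))%:R / (\dim {: K j1})%:R).
Proof.
rewrite /BL_slack addrAC; congr (_ - _); rewrite mulrBr.
rewrite /moved (eq_bigr (fun j => s j * (\dim (B j @: V))%:R +
   ((if j == j0 then t * ((\dim (B j @: V))%:R / (\dim {: K j0})%:R) else 0) -
    (if j == j1 then t * ((\dim (B j @: V))%:R / (\dim {: K j1})%:R) else 0)))).
  rewrite big_split sumrB; congr (_ + (_ - _)); rewrite -big_mkcond big_pred1_eq.
    by [].
  by [].
move=> j _; case: eqVneq => _; case: eqVneq => _ /=; ring.
Qed.

(** The motion stops when the first constraint becomes an equality: [s j0] reaches 1 or [s j1]
    reaches 0, so that an exponent ceases to be fractional, or a proper subspace becomes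
    critical. *)
Lemma exists_moved : exists2 t, 0 < t &
  [/\ forall j, 0 <= moved t j <= 1, BL_condition B (moved t) &
    (fractional K (moved t) \proper fractional K s) \/
    exists2 V : {vspace H}, (0 < \dim V < \dim {: H})%N & BL_slack B (moved t) V = 0].
Proof.
(* The slack of [V] depends only on the dimensions of [V] and of its images, so
   there are finitely many constraints. *)
pose N := \dim {: H}.
pose C := ('I_N.+1 * {ffun J -> 'I_N.+1})%type.
pose dims (V : {vspace H}) : C := (inord (\dim V), [ffun j => inord (\dim (B j @: V))]).
pose P c := `[< exists2 V : {vspace H}, (0 < \dim V < \dim {: H})%N & c = dims V >].
have dimsE V : ((dims V).1 = \dim V :> nat) /\
    forall j, (dims V).2 j = \dim (B j @: V) :> nat.
  split=> [|j]; rewrite /= ?ffunE inordK// ltnS ?dimvS ?subvf//.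
  by rewrite (leq_trans (dim_limg_le _ _))// dimvS// subvf.
(* Constraint [o] at time [t] is [0 <= a o + t * b o]: for [None], [s j0] stays at most 1; for
   [Some None], [s j1] stays nonnegative; the others are slacks. Dimension data of no proper nonzero
   subspace get the constant 1, which never vanishes. *)
pose a (o : option (option C)) : R := match o with
  | None => 1 - s j0
  | Some None => s j1
  | Some (Some c) => if P c then \sum_j s j * (c.2 j)%:R - (c.1)%:R else 1
  end.
pose b (o : option (option C)) : R := match o with
  | None => - (\dim {: K j0})%:R^-1
  | Some None => - (\dim {: K j1})%:R^-1
  | Some (Some c) => if P c then
      (c.2 j0)%:R / (\dim {: K j0})%:R - (c.2 j1)%:R / (\dim {: K j1})%:R else 0
  end.
have aE V : (0 < \dim V < \dim {: H})%N ->
    a (Some (Some (dims V))) = BL_slack B s V.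
  move=> dV; rewrite /a /P asboolT; last by exists V.
  have [-> dE] := dimsE V; rewrite /BL_slack; congr (_ - _).
  by apply: eq_bigr => j _; rewrite dE.
have bE V : (0 < \dim V < \dim {: H})%N -> b (Some (Some (dims V))) =
  (\dim (B j0 @: V))%:R / (\dim {: K j0})%:R - (\dim (B j1 @: V))%:R / (\dim {: K j1})%:R.
  move=> dV; rewrite /b /P asboolT; last by exists V.
  by have [_ dE] := dimsE V; rewrite !dE.
have a0 o : 0 < a o.
  case: o => [[c|]|] /=.
  - rewrite /P; case: asboolP => // -[V dV ->].
    have := aE V dV; rewrite /a /P asboolT; last by exists V.
    by move=> ->; exact: no_critical.
  - by move: fj1; rewrite inE => /andP[/andP[]].
  - by move: fj0; rewrite inE subr_gt0 => /andP[/andP[]].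
have [|t t0 [abt [c0 c00]]] := first_zero_affine a0 (b := b).
  by exists None; rewrite /b oppr_lt0 invr_gt0.
exists t => //.
have m0 : moved t j0 = s j0 + t / (\dim {: K j0})%:R.
  by rewrite /moved eqxx (negPf j01) mul0r subr0 mul1r.
have m1 : moved t j1 = s j1 - t / (\dim {: K j1})%:R.
  by rewrite /moved eqxx eq_sym (negPf j01) mul0r add0r mul1r mulrN.
have mj j : j != j0 -> j != j1 -> moved t j = s j.
  by move=> /negPf nj0 /negPf nj1; rewrite /moved nj0 nj1 !mul0r subrr mulr0 addr0.
have moved01 j : 0 <= moved t j <= 1.
  have /andP[sj0 sj1] := s01 j.
  have [->|jj0] := eqVneq j j0.
    rewrite m0 addr_ge0 ?divr_ge0//; try by [exact: ltW|have /andP[] := s01 j0].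
    by have := abt None; rewrite /a /b; lra.
  have [->|jj1] := eqVneq j j1.
    have := abt (Some None); rewrite /a /b m1 mulrN => ->/=.
    have /andP[_ s1] := s01 j1; apply: le_trans s1.
    by rewrite lerBlDr lerDl divr_ge0// ltW.
  by rewrite mj.
split => //.
  (* For the whole space both ratios in [moved_slack] are 1 by surjectivity, so the scaling identity
     survives. *)
  have fullE : BL_slack B (moved t) fullv = 0.
    by rewrite moved_slack !B_surj s_cond.1 !divff ?gt_eqF// subrr mulr0 addr0.
  split=> // V.
  have [dV|] := boolP (0 < \dim V < \dim {: H})%N.
    by have := abt (Some (Some (dims V))); rewrite aE// bE// moved_slack.
  rewrite negb_and -leqNgt leqn0 dimv_eq0 -leqNgt => /orP[/eqP->|dV].
    rewrite /BL_slack dimv0 subr0 sumr_ge0// => j _.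
    by rewrite limg0 dimv0 mulr0.
  have -> : V = fullv by apply/eqP; rewrite eqEdim subvf.
  by rewrite fullE.
have sub : fractional K (moved t) \subset fractional K s.
  apply/fintype.subsetP => j; have [->//|jj0] := eqVneq j j0.
  by have [->//|jj1] := eqVneq j j1; rewrite !inE mj.
case: c0 c00 => [[c|]|] /=.
- rewrite /P; case: asboolP => [[V dV ->]|_]; last lra.
  have := aE V dV; have := bE V dV; rewrite /a /b /P asboolT; last by exists V.
  move=> -> -> sl0; right; exists V => //.
  by rewrite moved_slack.
- move=> o0; left; apply/fintype.properP; split => //; exists j1 => //.
  by rewrite inE m1 (_ : _ - _ = 0) ?ltxx//; lra.
- move=> o0; left; apply/fintype.properP; split => //; exists j0 => //.
  by rewrite inE m0 (_ : _ + _ = 1) ?ltxx ?andbF//; lra.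
Qed.

End motion.
End BL_condition_finite.

Section BL_condition_finite.
Context {R : realType} (J : finType).

(** With [s j = 1], scaling says that the kernel has dimension
    [\sum_(i | i != j) s i * \dim {: K i}]. This dominates the weighted dimensions of the images of
    the kernel, so its slack is at most 0. If [H] and [K j] have equal dimension, the sum is 0 and
    vanishes term by term. *)
Lemma BL_condition_lker (H : finHilbertType R) (K : J -> finHilbertType R)
    (B : forall j, 'Hom(H, K j)) (s : J -> R) (j : J) :
    (forall j, 0 <= s j <= 1) -> (forall j, limg (B j) = fullv) ->
    BL_condition B s -> s j = 1 ->
  BL_slack B s (lker (B j)) = 0 /\
  (\dim {: H} = \dim {: K j} -> forall i, i != j -> s i = 0 \/ \dim {: K i} = 0%N).
Proof.
move=> s01 Bsurj [full0 slack0] sj1.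
have s0 i : 0 <= s i by have /andP[] := s01 i.
have dker : (\dim {: H})%:R = (\dim (lker (B j)))%:R + (\dim {: K j})%:R :> R.
  by rewrite -natrD -(limg_ker_dim (B j) fullv) capfv Bsurj.
have fullE : (\dim {: H})%:R = (\dim {: K j})%:R +
    \sum_(i | i != j) s i * (\dim {: K i})%:R :> R.
  have /eqP := full0; rewrite /BL_slack subr_eq0 => /eqP <-.
  rewrite (bigD1 j)//= Bsurj sj1 mul1r; congr (_ + _).
  by apply: eq_bigr => i _; rewrite Bsurj.
split.
  apply/eqP; rewrite eq_le slack0 andbT /BL_slack (bigD1 j)//=.
  rewrite (_ : (B j @: lker (B j) = 0)%VS); last first.
    by apply/eqP; rewrite -lkerE subvv.
  rewrite dimv0 mulr0 add0r subr_le0.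
  rewrite (_ : (\dim (lker (B j)))%:R = \sum_(i | i != j) s i * (\dim {: K i})%:R); last lra.
  apply: ler_sum => i _; rewrite ler_wpM2l// ler_nat.
  by rewrite dimvS// subvf.
move=> dHK i ij; have sum0 : \sum_(i | i != j) s i * (\dim {: K i})%:R = 0 :> R.
  by move: fullE; rewrite dHK; lra.
have := psumr_eq0P (fun k _ => mulr_ge0 (s0 k) (ler0n R (\dim {: K k}))) sum0.
move=> /(_ i ij)/eqP; rewrite mulf_eq0 pnatr_eq0 => /orP[/eqP->|/eqP->]; [by left|by right].
Qed.

(** The outer induction, on [\dim {: H}], handles critical subspaces; the inner one, on the number
    of fractional exponents, handles moves. *)
Lemma BL_condition_finite (H : finHilbertType R) (K : J -> finHilbertType R)
    (B : forall j, 'Hom(H, K j)) (s : J -> R) :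
    (forall j, limg (B j) = fullv) -> (forall j, 0 <= s j <= 1) ->
  BL_condition B s -> BL_finite B s.
Proof.
have [n] := ubnP (\dim {: H}); elim: n H K B s => // n IHn H K B s /[!ltnS] dHn Bsurj.
have [k] := ubnP #|fractional K s|; elim: k s => // k IHk s /[!ltnS] fk s01 sc.
have crit_done (s' : J -> R) : (forall j, 0 <= s' j <= 1) -> BL_condition B s' ->
    (exists2 V : {vspace H}, (0 < \dim V < \dim {: H})%N & BL_slack B s' V = 0) ->
    BL_finite B s'.
  move=> s'01 s'c [V dV slV].
  apply: (BL_condition_critical s'01 Bsurj s'c slV dV) => H' K' B' dH' B'surj.
  by apply: IHn => //; exact: leq_trans dH' dHn.
have [|nocrit] := pselect (exists2 V : {vspace H}, (0 < \dim V < \dim {: H})%N &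
  BL_slack B s V = 0); first exact: crit_done.
have {}nocrit (V : {vspace H}) : (0 < \dim V < \dim {: H})%N -> 0 < BL_slack B s V.
  move=> dV; rewrite lt_neqAle sc.2 andbT eq_sym; apply/eqP => sl0.
  by apply: nocrit; exists V.
have dK j : (\dim {: K j} <= \dim {: H})%N by rewrite -(Bsurj j) dim_limg_le.
have [dH0|dH0] := posnP (\dim {: H}).
  by apply: BL_finite_trivial => // j; right; apply/eqP; rewrite -leqn0 -dH0.
have [[j sj1 dKj]|none1] := pselect (exists2 j, s j = 1 & (0 < \dim {: K j})%N).
  have [sl0 sK] := BL_condition_lker s01 Bsurj sc sj1.
  have := limg_ker_dim (B j) fullv; rewrite capfv Bsurj => dker.
  (* A trivial kernel makes [B j] bijective. Otherwise the kernel is critical, and proper because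
     [K j] has positive dimension. *)
  have [dker0|dker0] := posnP (\dim (lker (B j))).
    have dHK : \dim {: H} = \dim {: K j} by rewrite -dker dker0.
    by apply: (BL_finite_bijective sj1 dHK (Bsurj j)); exact: sK.
  apply: crit_done => //; exists (lker (B j)) => //.
  by rewrite dker0 -dker -[ltnLHS]addn0 ltn_add2l.
(* From here on every exponent that contributes to the scaling identity lies strictly between 0 and
   1. *)
have s_frac j : s j * (\dim {: K j})%:R != 0 -> j \in fractional K s.
  rewrite mulf_eq0 pnatr_eq0 negb_or -lt0n => /andP[sj0 dKj].
  have /andP[sj_ge0 sj_le1] := s01 j.
  rewrite inE dKj andbT lt_neqAle eq_sym sj0 sj_ge0 lt_neqAle sj_le1 !andbT.
  by apply/eqP => sj1; apply: none1; exists j.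
have fullE : \sum_j s j * (\dim {: K j})%:R = (\dim {: H})%:R :> R.
  have /eqP := sc.1; rewrite /BL_slack subr_eq0 => /eqP <-.
  by apply: eq_bigr => j _; rewrite Bsurj.
have [j0 sj0] : exists j, s j * (\dim {: K j})%:R != 0.
  apply: contrapT => /forallNP all0; move: fullE; rewrite big1 => [/esym/eqP|j _].
    by rewrite pnatr_eq0 gtn_eqF.
  by apply/eqP/negP => /negP; exact: all0.
have fj0 := s_frac j0 sj0.
(* A single fractional exponent would give [dim H = s j0 * dim K j0 < dim K j0]. *)
have [j1 j10 sj1] : exists2 j, j != j0 & s j * (\dim {: K j})%:R != 0.
  apply: contrapT => all0; move: fullE; rewrite (bigD1 j0)//= big1 => [|j jj0].
    move: fj0; rewrite inE addr0 => /andP[/andP[_ s1] dKj] sE.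
    have : s j0 * (\dim {: K j0})%:R < (\dim {: H})%:R.
      rewrite (@lt_le_trans _ _ (\dim {: K j0})%:R) ?ler_nat//.
      by rewrite gtr_pMl// ltr0n.
    by rewrite sE ltxx.
  by apply/eqP/negP => /negP sj; apply: all0; exists j.
have fj1 := s_frac j1 sj1.
have move_done i0 i1 (t : R) : BL_condition B (moved K s i0 i1 t) ->
    (forall j, 0 <= moved K s i0 i1 t j <= 1) ->
    (fractional K (moved K s i0 i1 t) \proper fractional K s) \/
    (exists2 V : {vspace H}, (0 < \dim V < \dim {: H})%N &
      BL_slack B (moved K s i0 i1 t) V = 0) -> BL_finite B (moved K s i0 i1 t).
  move=> mc m01 [/proper_card lt_frac|]; last exact: crit_done.
  by apply: IHk => //; exact: leq_trans lt_frac fk.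
(* Exchanging the roles of [j0] and [j1] reverses the direction of motion. *)
have [t t0 [m01 mc mP]] := exists_moved Bsurj s01 sc nocrit (j10 : j1 != j0) fj1 fj0.
have j01 : j0 != j1 by rewrite eq_sym.
have [u u0 [m01' mc' mP']] := exists_moved Bsurj s01 sc nocrit j01 fj0 fj1.
have tu0 : 0 < t + u by rewrite addr_gt0.
(* The end points lie at distances [t] and [u] on opposite sides of [s], so the weights
   [u / (t + u)] and [t / (t + u)] give back [s]. *)
have th01 : 0 < u / (t + u) < 1.
  by rewrite divr_gt0//= ltr_pdivrMr// mul1r ltrDr.
have m_ge0 i0 i1 v : (forall j, 0 <= moved K s i0 i1 v j <= 1) ->
    forall j, 0 <= moved K s i0 i1 v j by move=> h j; have /andP[] := h j.
have := BL_finite_convex th01 (m_ge0 _ _ _ m01) (m_ge0 _ _ _ m01')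
  (move_done _ _ _ mc m01 mP) (move_done _ _ _ mc' m01' mP').
congr (BL_finite B _); apply/funext => j; rewrite /moved.
have dim_neq0 i : i \in fractional K s -> (\dim {: K i})%:R != 0 :> R.
  by rewrite inE pnatr_eq0 -lt0n => /andP[].
by field; rewrite !dim_neq0//= gt_eqF.
Qed.

End BL_condition_finite.

(** * Lebesgue norms and infinite exponents *)

Section surjective_ae.
Context {R : realType} (H K : finHilbertType R) (B : 'Hom(H, K)).
Hypothesis B_surj : limg B = fullv.
Local Open Scope ereal_scope.

(** The preimage of [N] is invariant along the kernel of [B], and [B] maps a complement of the
    kernel bijectively onto [K]; Tonelli concludes. It lets essential bounds on [K] be pulled back
    along [B]. *)
Lemma lebesgue_hilbert_preimage0 (N : set (borel K)) : measurable N ->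
  lebesgue_hilbert K N = 0 -> lebesgue_hilbert H ((B : borel H -> borel K) @^-1` N) = 0.
Proof.
move=> mN N0; have [V W i1 i2 r1 r2 sp iU] := split_subspace (lker B).
have [_ i2K r2i1 _ iE] := sp.
have Bi1 v : B (i1 v) = 0%R.
  by apply/eqP; rewrite -memv_ker -iU memv_img// memvf.
have BBi2 y : exists w, B (i2 w) = y.
  have /memv_imgP[x _ ->] : y \in limg B by rewrite B_surj memvf.
  by exists (r2 x); rewrite -{2}[x]iE linearD/= Bi1 add0r.
have ker0 : lker (B \o i2)%VF == 0%VS.
  apply/lker0P => w1 w2; rewrite !comp_lfunE => /eqP; rewrite -subr_eq0 -!linearB/=.
  rewrite -memv_ker -iU => /memv_imgP[v _ e]; apply/eqP; rewrite -subr_eq0.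
  by rewrite -[X in X == _]i2K e r2i1.
have BVK : cancel (B \o i2)^-1%VF (B \o i2)%VF.
  move=> y; apply: limg_lfunVK; apply/memv_imgP.
  by have [w <-] := BBi2 y; exists w; rewrite ?memvf// comp_lfunE.
have [c c0 cP] := integral_splitting sp.
have [e e0 eP] := integral_linear_bijection (lker0_lfunK ker0) BVK.
pose h (y : borel K) : \bar R := (\1_N y)%:E.
have mh : measurable_fun setT h by exact/measurable_EFinP.
have h0 y : 0 <= h y by rewrite lee_fin.
have mBN : measurable ((B : borel H -> borel K) @^-1` N).
  by rewrite -[X in measurable X]setTI; exact: measurable_hom.
have : \int[lebesgue_hilbert W]_w \int[lebesgue_hilbert V]_v h (B (i1 v + i2 w)%R) = 0.
  (* The inner integrand does not depend on [v]. The mass of [V] may be infinite, but the outer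
     integral is 0 and [0 * +oo = 0]. *)
  under eq_integral => w _.
    under eq_integral do rewrite linearD/= Bi1 add0r.
    rewrite integral_cst//. over.
  rewrite ge0_integralZr//; last first.
    exact: (measurableT_comp mh (measurableT_comp (measurable_hom B) (measurable_hom i2))).
  rewrite (_ : \int[_]_w _ = \int[lebesgue_hilbert W]_w h ((B \o i2)%VF w)); last first.
    by apply: eq_integral => w _; rewrite comp_lfunE.
  by rewrite eP// integral_indic//= setIT N0 mule0 mul0e.
rewrite (cP (fun x => h (B x)))//; last exact: (measurableT_comp mh (measurable_hom B)).
rewrite (_ : \int[_]_x _ = lebesgue_hilbert H ((B : borel H -> borel K) @^-1` N)); last first.
  by rewrite -[X in _ = _ X]setIT -integral_indic.
by move/eqP; rewrite mule_eq0 gt_eqF//= => /eqP.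
Qed.

Lemma ae_surjective (P : set (borel K)) :
  {ae lebesgue_hilbert K, forall y, P y} -> {ae lebesgue_hilbert H, forall x, P (B x)}.
Proof.
move=> [N [mN N0 PN]]; exists ((B : borel H -> borel K) @^-1` N); split.
- by rewrite -[X in measurable X]setTI; exact: measurable_hom.
- exact: lebesgue_hilbert_preimage0.
- by move=> x /= Px; apply: PN.
Qed.

End surjective_ae.

Lemma recip_EFin {R : realType} (r : R) : recip r%:E = r^-1.
Proof. by rewrite /recip inver; case: eqP => //= ->; rewrite invr0. Qed.

Lemma recip_pinfty {R : realType} : recip (+oo%E : \bar R) = 0.
Proof. by []. Qed.

Lemma recip_ge0_le1 {R : realType} (q : \bar R) : (1 <= q)%E -> (0 <= recip q <= 1).
Proof.
case: q => [r| |]//; last by rewrite recip_pinfty lexx ler01.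
rewrite lee_fin recip_EFin => r1; have r0 : (0 < r) by exact: lt_le_trans r1.
by rewrite invr_ge0 ltW//= invf_le1.
Qed.

Section BL_Lnorm.
Context {R : realType} (H : finHilbertType R) (J : finType).
Context (K : J -> finHilbertType R) (B : forall j, 'Hom(H, K j)) (p : J -> \bar R).
Hypothesis B_surj : forall j, limg (B j) = fullv.
Hypothesis p_ge1 : forall j, (1 <= p j)%E.
Local Open Scope ereal_scope.

Lemma BL_finite_Lnorm : BL_finite B (fun j => recip (p j)) ->
  exists2 C : R, (0 < C)%R & forall f : forall j, borel (K j) -> \bar R,
    (forall j, measurable_fun setT (f j)) -> (forall j y, 0 <= f j y) ->
    \int[lebesgue_hilbert H]_x \prod_j f j (B j x) <=
    C%:E * \prod_j 'N[lebesgue_hilbert (K j)]_(p j)[f j].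
Proof.
move=> [C C0 BL]; exists C => // f mf f0.
(* For [p j = +oo], [fine (p j) = 0] makes [g j] constantly 1; the factor is then carried by the
   essential supremum [M j]. *)
pose g j (y : borel (K j)) := f j y `^ fine (p j).
have mg j : measurable_fun setT (g j) by exact: measurable_funT_poweR.
have g0 j y : 0 <= g j y by exact: poweR_ge0.
pose N j := 'N[lebesgue_hilbert (K j)]_(p j)[f j].
pose M j := if p j == +oo then N j else 1.
have M0 j : 0 <= M j by rewrite /M; case: ifP => // _; exact: Lnorm_ge0.
have fM : {ae lebesgue_hilbert H, forall x, forall j,
    f j (B j x) <= M j * g j (B j x) `^ recip (p j)}.
  apply: filter_forall => j; rewrite /M /g /N; move: (p_ge1 j).
  case: (p j) => [r| |]//.
    rewrite lee_fin => r1; apply/nearW => x /=; rewrite mul1e recip_EFin -poweRrM.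
    by rewrite mulfV ?poweRe1// gt_eqF// (lt_le_trans ltr01).
  move=> _; apply: (@ae_surjective _ _ _ (B j) (B_surj j)
    (fun y => f j y <=
      'N[lebesgue_hilbert (K j)]_+oo[f j] * (f j y `^ fine +oo) `^ recip +oo)).
  rewrite unlock lebesgue_hilbert_gt0.
  have := @ess_sup_ge _ _ _ (lebesgue_hilbert (K j)) (abse \o f j).
  apply: filterS => y /=; rewrite gee0_abs// => h.
  by rewrite recip_pinfty poweRe0 mule1.
have NE j : M j * (\int[lebesgue_hilbert (K j)]_y g j y) `^ recip (p j) = N j.
  rewrite /M /N /g; move: (p_ge1 j); case: (p j) => [r| |]//.
    rewrite lee_fin => r1; rewrite mul1e recip_EFin unlock; congr (_ `^ _).
    by apply: eq_integral => y _; rewrite gee0_abs.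
  by rewrite recip_pinfty poweRe0 mule1.
apply: (@le_trans _ _ (\int[lebesgue_hilbert H]_x
    ((\prod_j M j) * \prod_j (g j (B j x) `^ recip (p j))))).
  apply: ae_ge0_le_integral => //.
  - by move=> x _; exact: prode_ge0.
  - apply: (@emeasurable_prod _ _ _ _ _ _ (fun j (x : borel H) => f j (B j x))) => j.
    exact: (measurableT_comp (mf j) (measurable_hom (B j))).
  - move=> x _; rewrite mule_ge0//; first exact: prode_ge0.
    by apply: prode_ge0 => j _; exact: poweR_ge0.
  - by apply: measurable_funeM; exact: measurable_BL_integrand.
  have Fae : Filter (almost_everywhere (lebesgue_hilbert H)).
    exact: ae_filter_ringOfSetsType.
  apply: (filterS _ fM) => x h _; rewrite -big_split/=.
  by apply: lee_prod => j _.
rewrite ge0_integralZl//; last 3 first.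
- exact: measurable_BL_integrand.
- by move=> x _; apply: prode_ge0 => j _; exact: poweR_ge0.
- exact: prode_ge0.
apply: (le_trans (lee_wpmul2l (prode_ge0 _ (fun j _ => M0 j)) (BL g mg g0))).
by rewrite muleCA -big_split/=; under eq_bigr do rewrite NE.
Qed.

End BL_Lnorm.

(** * Sufficiency *)

Section sufficiency.
Context {R : realType} {n m : nat}.
Variables (H : 'I_n -> finHilbertType R) (K : 'I_m -> finHilbertType R).
Variable A : 'I_n -> 'I_m -> finType.
Variable B : forall (i : 'I_n) (j : 'I_m), A i j -> 'Hom(H i, K j).
Variable p : 'I_m -> \bar R.
Hypothesis B_surj : forall i j (a : A i j), limg (B a) = {: K j}%VS.
Hypothesis p_ge1 : forall j, (1 <= p j)%E.

Local Notation arrows i := {j : 'I_m & A i j}.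

Lemma prod_arrows_tag (i : 'I_n) (F : forall j, A i j -> \bar R) :
  (\prod_(j < m) \prod_(a : A i j) F j a = \prod_(u : arrows i) F (tag u) (tagged u))%E.
Proof. by rewrite (sig_big_dep (J := A i) _ (fun _ => xpredT) F). Qed.

Lemma sum_arrows_tag (i : 'I_n) (F : forall j, A i j -> R) :
  \sum_(j < m) \sum_(a : A i j) F j a = \sum_(u : arrows i) F (tag u) (tagged u).
Proof. by rewrite (sig_big_dep (J := A i) _ (fun _ => xpredT) F). Qed.

Lemma BLCD_lty :
    \sum_(i < n) (\dim {: H i})%:R =
      \sum_(j < m) (alpha A j)%:R * recip (p j) * (\dim {: K j})%:R :> R ->
    (forall V : forall i : 'I_n, {vspace H i},
      \sum_(i < n) (\dim (V i))%:R <= \sum_(i < n) \sum_(j < m) \sum_(a : A i j)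
        recip (p j) * (\dim (B a @: V i)%VS)%:R :> R) ->
  (BLCD B p < +oo)%E.
Proof.
move=> full sub.
pose s i (u : arrows i) := recip (p (tag u)).
pose slack i := BL_slack (fun u : arrows i => B (tagged u)) (@s i).
have slackE i W : slack i W = \sum_(j < m) \sum_(a : A i j)
    recip (p j) * (\dim (B a @: W)%VS)%:R - (\dim W)%:R.
  by rewrite sum_arrows_tag.
(* Take the zero subspace at every source other than [i]. *)
have slack_ge0 i W : 0 <= slack i W.
  pose V := @eqtype.dfwith _ (fun i => {vspace H i}) (fun=> 0%VS) i W.
  have := sub V; rewrite -subr_ge0 -sumrB (bigD1 i)//= [X in _ + X]big1 => [|k ki].
    by rewrite addr0 slackE /V dfwith_in.
  rewrite /V dfwith_out 1?eq_sym// dimv0 subr0 big1// => j _.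
  by rewrite big1// => a _; rewrite limg0 dimv0 mulr0.
(* These slacks are nonnegative and sum to 0 by the scaling identity, so scaling holds at each
   source separately. *)
have slack_full i : slack i fullv = 0.
  suff : \sum_i slack i fullv = 0.
    by move=> /psumr_eq0P; apply => // k _; exact: slack_ge0.
  under eq_bigr do rewrite slackE; rewrite sumrB full exchange_big/=.
  apply/eqP; rewrite subr_eq0; apply/eqP; apply: eq_bigr => j _.
  rewrite -mulrA /alpha natr_sum mulr_suml; apply: eq_bigr => i' _.
  rewrite (eq_bigr (fun=> recip (p j) * (\dim {: K j})%:R)) => [|a _]; last by rewrite B_surj.
  by rewrite sumr_const mulr_natl.
have /choice[C CP] i : exists C : R, 0 < C /\
    forall f : forall u : arrows i, borel (K (tag u)) -> \bar R,
    (forall u, measurable_fun setT (f u)) -> (forall u y, (0 <= f u y)%E) ->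
    (\int[lebesgue_hilbert (H i)]_x \prod_u f u (B (tagged u) x) <=
    C%:E * \prod_u 'N[lebesgue_hilbert (K (tag u))]_(p (tag u))[f u])%E.
  have [|u||C C0 CP] := @BL_finite_Lnorm _ (H i) _ (fun u : arrows i => K (tag u))
    (fun u => B (tagged u)) (fun u => p (tag u)).
  - by move=> u; exact: B_surj.
  - exact: p_ge1.
  - apply: BL_condition_finite => [u|u|]; first exact: B_surj.
      exact: recip_ge0_le1.
    by split=> [|W]; [exact: slack_full|exact: slack_ge0].
  by exists C.
apply: (@le_lt_trans _ _ (\prod_i C i)%:E); last exact: ltry.
apply: ereal_inf_lbound; split=> [|f mf f0].
  by rewrite lee_fin prodr_ge0// => i _; have [/ltW] := CP i.
rewrite -prodEFin -big_split/=; apply: lee_prod => i _.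
  by apply: integral_ge0 => x _; do 2 apply: prode_ge0 => ? _.
(* The inequality at source [i] allows a different function on each arrow; here arrows with the same
   target share one. *)
have [_ /(_ (fun u => f (tag u)) (fun u => mf _) (fun u => f0 _))] := CP i.
under eq_integral do rewrite -(prod_arrows_tag (fun j a => f j (B a _))).
by rewrite -(prod_arrows_tag (fun j a => 'N[lebesgue_hilbert (K j)]_(p j)[f j]%E)).
Qed.

End sufficiency.

(** * Necessity *)

Section test_functions.
Context {R : realType} {n m : nat}.
Variables (H : 'I_n -> finHilbertType R) (K : 'I_m -> finHilbertType R).
Variable A : 'I_n -> 'I_m -> finType.
Variable B : forall (i : 'I_n) (j : 'I_m), A i j -> 'Hom(H i, K j).
Variable p : 'I_m -> \bar R.
Hypothesis p_ge1 : forall j, (1 <= p j)%E.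
Local Open Scope ereal_scope.

(* The same function [f j] serves all arrows into [j], so it is built from the
   sum over these arrows of the normalised indicators. *)
Lemma BLCD_test_sets (C : \bar R) (E : forall i, set (borel (H i)))
    (S : forall i j, A i j -> set (borel (K j))) (sigma : forall i j, A i j -> R) :
    is_BLCD_constant B p C -> (forall i, measurable (E i)) ->
    (forall i j (a : A i j), measurable (S i j a)) ->
    (forall i j (a : A i j), (0 < sigma i j a)%R) ->
    (forall i j (a : A i j), lebesgue_hilbert (K j) (S i j a) = (sigma i j a)%:E) ->
    (forall i j (a : A i j) (x : H i), E i x -> S i j a (B a x)) ->
  \prod_(i < n) (lebesgue_hilbert (H i) (E i) *
    (\prod_(j < m) \prod_(a : A i j) (sigma i j a `^ (- recip (p j))))%R%:E) <=
  C * \prod_(i < n) \prod_(j < m) \prod_(a : A i j) ((alpha A j)%:R `^ recip (p j))%:E.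
Proof.
move=> [C0 CP] mE mS s0 SE ES.
pose phi j (y : borel (K j)) : R :=
  (\sum_(i < n) \sum_(a : A i j) (sigma i j a)^-1 * \1_(S i j a) y)%R.
have phi0 j y : (0 <= phi j y)%R.
  by do 2 apply: sumr_ge0 => ? _; rewrite mulr_ge0// invr_ge0 ltW.
have mphi j : measurable_fun setT (phi j).
  do 2 apply: measurable_sum => ?.
  by apply: measurable_funM => //; exact: measurable_indic.
have Iphi j : \int[lebesgue_hilbert (K j)]_y (phi j y)%:E = (alpha A j)%:R%:E.
  under eq_integral => y _.
    rewrite -sumEFin; under eq_bigr do rewrite -sumEFin. over.
  rewrite ge0_integral_sum//; last 2 first.
  - move=> i; apply: emeasurable_sum => a; apply/measurable_EFinP.
    by apply: measurable_funM => //; exact: measurable_indic.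
  - by move=> i y _; apply: sume_ge0 => a _; rewrite lee_fin mulr_ge0// invr_ge0 ltW.
  rewrite /alpha natr_sum -sumEFin; apply: eq_bigr => i _.
  rewrite ge0_integral_sum//; last 2 first.
  - move=> a; apply/measurable_EFinP.
    by apply: measurable_funM => //; exact: measurable_indic.
  - by move=> a y _; rewrite lee_fin mulr_ge0// invr_ge0 ltW.
  rewrite (eq_bigr (fun=> 1%:E)) => [|a _]; first by rewrite sumEFin sumr_const.
  under eq_integral do rewrite EFinM.
  rewrite ge0_integralZl_EFin//; last 2 first.
  - by apply/measurable_EFinP; exact: measurable_indic.
  - by rewrite invr_ge0 ltW.
  by rewrite integral_indic//= setIT SE -EFinM mulVf// gt_eqF.
pose f j (y : borel (K j)) : \bar R := (phi j y `^ recip (p j))%R%:E.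
have mf j : measurable_fun setT (f j).
  apply/measurable_EFinP.
  exact: (measurableT_comp (measurable_powR (recip (p j))) (mphi j)).
have f0 j y : 0 <= f j y by rewrite lee_fin powR_ge0.
(* For finite [p j] this is the integral of [phi j] raised to [1 / p j]; for [p j = +oo] the
   exponent is 0 and [f j] is constantly 1. *)
have Nf j : 'N[lebesgue_hilbert (K j)]_(p j)[f j] = ((alpha A j)%:R `^ recip (p j))%:E.
  rewrite unlock /f; move: (p_ge1 j); case: (p j) => [r| |]//.
    rewrite lee_fin recip_EFin => r1; have r0 : (0 < r)%R by exact: lt_le_trans r1.
    rewrite -poweR_EFin -Iphi; congr (_ `^ _); apply: eq_integral => y _.
    rewrite gee0_abs ?lee_fin ?powR_ge0// poweR_EFin -powRrM mulVf ?gt_eqF//.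
    by rewrite powRr1.
  move=> _; rewrite lebesgue_hilbert_gt0 recip_pinfty powRr0.
  apply: ess_sup_ae_cst; first exact: lebesgue_hilbert_gt0.
  by apply: aeW => y /=; rewrite powRr0 normr1.
have := CP f mf f0; under [X in _ <= _ * X -> _]eq_bigr do
  under eq_bigr do under eq_bigr do rewrite Nf.
apply: le_trans; apply: lee_prod => i _.
  rewrite mule_ge0// lee_fin; do 2 apply: prodr_ge0 => ? _; exact: powR_ge0.
have -> : lebesgue_hilbert (H i) (E i) = \int[lebesgue_hilbert (H i)]_x (\1_(E i) x)%:E.
  by rewrite integral_indic// setIT.
rewrite -ge0_integralZr//; last 2 first.
- by apply/measurable_EFinP; exact: measurable_indic.
- rewrite lee_fin; do 2 apply: prodr_ge0 => ? _; exact: powR_ge0.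
apply: ge0_le_integral => //.
- move=> x _; rewrite mule_ge0// ?lee_fin//.
  do 2 apply: prodr_ge0 => ? _; exact: powR_ge0.
- apply: emeasurable_funM; last exact: measurable_cst.
  by apply/measurable_EFinP; exact: measurable_indic.
- apply: (@emeasurable_prod _ _ _ _ _ _
    (fun j (x : borel (H i)) => \prod_(a : A i j) f j (B a x))) => j.
  apply: (@emeasurable_prod _ _ _ _ _ _ (fun a (x : borel (H i)) => f j (B a x))) => a.
  exact: (measurableT_comp (mf j) (measurable_hom (B a))).
move=> x _; rewrite indicE; have [|_] := boolP (x \in E i); last first.
  by rewrite mul0e; do 2 apply: prode_ge0 => ? _.
rewrite inE mul1e => Ex; rewrite -prodEFin; apply: lee_prod => j _.
  by rewrite lee_fin; apply: prodr_ge0 => ? _; exact: powR_ge0.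
rewrite -prodEFin; apply: lee_prod => a _; first by rewrite lee_fin powR_ge0.
rewrite lee_fin -mulN1r powRrM powR_inv1 ?(ltW (s0 _ _ _))//.
have /andP[rp0 _] := recip_ge0_le1 (p_ge1 j).
apply: ge0_ler_powR => //; rewrite ?nnegrE ?invr_ge0 ?(ltW (s0 _ _ _))//.
(* The term of the arrow [a] alone is already [(sigma i j a)^-1], since [B a x] lies in its set. *)
rewrite /phi (bigD1 i)//= (bigD1 a)//= indicE mem_set ?mulr1; last exact: ES.
rewrite -addrA lerDl addr_ge0//.
  by apply: sumr_ge0 => ? _; rewrite mulr_ge0// invr_ge0 ltW.
by do 2 apply: sumr_ge0 => ? _; rewrite mulr_ge0// invr_ge0 ltW.
Qed.

End test_functions.

(** * Dilations along a subspace *)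

Section stretch.
Context {R : realType}.

(** The change of variables gives an unknown constant; [hilbert_box t], whose preimage is
    [hilbert_box 1], identifies it. *)
Lemma ge0_integral_dilation (V : finHilbertType R) (t : R) : 0 < t ->
  forall h : borel V -> \bar R, measurable_fun setT h -> (forall x, 0 <= h x)%E ->
  (\int[lebesgue_hilbert V]_x h (t *: (x : V))%R =
   ((t ^+ \dim {: V})^-1)%:E * \int[lebesgue_hilbert V]_x h x)%E.
Proof.
move=> t0.
have K1 (a b : R) : a * b = 1 -> cancel (a *: \1 : 'End(V))%VF (b *: \1 : 'End(V))%VF.
  by move=> ab x; rewrite !scale_lfunE !id_lfunE scalerA mulrC ab scale1r.
have [c c0 cP] := integral_linear_bijection (K1 t t^-1 (mulfV (lt0r_neq0 t0)))
  (K1 t^-1 t (mulVf (lt0r_neq0 t0))).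
have {}cP (h : borel V -> \bar R) : measurable_fun setT h -> (forall x, 0 <= h x)%E ->
    (\int[lebesgue_hilbert V]_x h (t *: (x : V))%R =
     c%:E * \int[lebesgue_hilbert V]_x h x)%E.
  move=> mh h0; rewrite -cP//; apply: eq_integral => x _.
  by rewrite scale_lfunE id_lfunE.
suff -> : (t ^+ \dim {: V})^-1 = c by [].
pose h (x : borel V) : \bar R := (\1_(hilbert_box t) x)%:E.
have mh : measurable_fun setT h.
  by apply/measurable_EFinP/measurable_indic; exact: measurable_hilbert_box.
have h0 x : (0 <= h x)%E by rewrite lee_fin.
have boxE : (fun x : borel V => t *: (x : V) : borel V) @^-1` hilbert_box t = hilbert_box 1.
  by apply/seteqP; split => x hx k; have := hx k;
    rewrite /= dotpZl normrM gtr0_norm// ger_pMr.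
have e1 : (\int[lebesgue_hilbert V]_x h (t *: (x : V))%R = (2 ^+ \dim {: V})%:E)%E.
  have := lebesgue_hilbert_box V ltr01; rewrite mulr1 => <-.
  rewrite -[in RHS](setIT (hilbert_box 1)) -integral_indic//.
    by apply: eq_integral => x _; rewrite -boxE.
  exact: measurable_hilbert_box.
have e2 : (\int[lebesgue_hilbert V]_x h x = ((2 * t) ^+ \dim {: V})%:E)%E.
  rewrite integral_indic//= ?setIT ?lebesgue_hilbert_box//.
  exact: measurable_hilbert_box.
have := cP h mh h0; rewrite e1 e2 -EFinM exprMn => -[ce].
have two0 : (2 ^+ \dim {: V} : R) != 0 by rewrite expf_neq0// pnatr_eq0.
have td0 : t ^+ \dim {: V} != 0 by rewrite expf_neq0// gt_eqF.
apply: (mulIf two0); rewrite {1}ce; move: td0; set b := t ^+ _ => b0; set a := 2 ^+ _.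
by field.
Qed.

Definition stretch (H V W : finHilbertType R) (i1 : 'Hom(V, H)) (i2 : 'Hom(W, H))
    (r1 : 'Hom(H, V)) (r2 : 'Hom(H, W)) (t : R) : 'End(H) :=
  t *: (i1 \o r1)%VF + (i2 \o r2)%VF.

Section stretch_theory.
Variables (H V W : finHilbertType R).
Variables (i1 : 'Hom(V, H)) (i2 : 'Hom(W, H)) (r1 : 'Hom(H, V)) (r2 : 'Hom(H, W)).
Hypothesis sp : splitting i1 i2 r1 r2.
Local Notation stretch := (stretch i1 i2 r1 r2).

Lemma stretchE t x : stretch t x = t *: i1 (r1 x) + i2 (r2 x).
Proof. by rewrite add_lfunE scale_lfunE !comp_lfunE. Qed.

Lemma stretch_inl t x : r1 (stretch t x) = t *: r1 x.
Proof.
have [i1K _ _ r1i2 _] := sp.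
by rewrite stretchE linearD linearZ/= i1K r1i2 addr0.
Qed.

Lemma stretch_inr t x : r2 (stretch t x) = r2 x.
Proof.
have [_ i2K r2i1 _ _] := sp.
by rewrite stretchE linearD linearZ/= i2K r2i1 scaler0 add0r.
Qed.

Lemma stretchK t : t != 0 -> cancel (stretch t^-1) (stretch t).
Proof.
move=> t0 x; have [_ _ _ _ iE] := sp.
by rewrite stretchE stretch_inl stretch_inr linearZ/= scalerA mulfV// scale1r iE.
Qed.

(** The set on the left is the image of [E] under [stretch t]. Along the splitting only the integral
    over [V] is rescaled, and the constant of the splitting cancels. *)
Lemma lebesgue_hilbert_stretch t (E : set (borel H)) : 0 < t -> measurable E ->
  (lebesgue_hilbert H ((stretch t^-1 : borel H -> borel H) @^-1` E) =
   (t ^+ \dim {: V})%:E * lebesgue_hilbert H E)%E.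
Proof.
move=> t0 mE; have [i1K i2K r2i1 r1i2 iE] := sp.
have [c c0 cP] := integral_splitting sp.
pose h (x : borel H) : \bar R := (\1_E x)%:E.
have mh : measurable_fun setT h by apply/measurable_EFinP/measurable_indic.
have h0 x : (0 <= h x)%E by rewrite lee_fin.
pose hs (x : borel H) : \bar R := h (stretch t^-1 x).
have mhs : measurable_fun setT hs by exact: (measurableT_comp mh (measurable_hom _)).
have -> : lebesgue_hilbert H ((stretch t^-1 : borel H -> borel H) @^-1` E) =
    (\int[lebesgue_hilbert H]_x hs x)%E.
  rewrite -[LHS](congr1 (lebesgue_hilbert H) (setIT _)) -integral_indic//.
  by rewrite -[X in measurable X]setTI; exact: measurable_hom.
have -> : lebesgue_hilbert H E = (\int[lebesgue_hilbert H]_x h x)%E.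
  by rewrite integral_indic// setIT.
suff : (c%:E * (\int[lebesgue_hilbert H]_x hs x) =
    c%:E * ((t ^+ \dim {: V})%:E * \int[lebesgue_hilbert H]_x h x))%E.
  move=> /(congr1 (fun z => c^-1%:E * z)%E).
  by rewrite !muleA -!EFinM mulVf ?gt_eqF// mul1r !mul1e.
rewrite -(cP hs mhs (fun x => h0 _)) muleCA -(cP h mh h0).
rewrite -ge0_integralZl_EFin ?exprn_ge0 ?(ltW t0)//; last 2 first.
- by move=> w _; exact: integral_ge0.
- have := measurable_fun_fubini_tonelli_F (m2 := lebesgue_hilbert V)
      (fun z : (borel W * borel V)%type => h (i1 z.2 + i2 z.1)%R)
      (measurableT_comp mh (measurable_combine i1 i2)).
  by apply => z; exact: h0.
apply: eq_integral => w _.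
have hsE v : hs (i1 v + i2 w) = h (i1 (t^-1 *: v) + i2 w).
  rewrite /hs stretchE (linearD r1) (linearD r2)/= i1K i2K r2i1 r1i2 addr0 add0r.
  by rewrite linearZ.
under eq_integral do rewrite hsE.
have := @ge0_integral_dilation V t^-1 _ (fun v => h (i1 v + i2 w)).
rewrite invr_gt0 exprVn invrK => /(_ t0); apply => //.
apply: (measurableT_comp mh); apply: measurable_borelD => //.
exact: measurable_hom.
Qed.

End stretch_theory.

(** The coordinates of [f x] combine those of [x], which are at most 1 in absolute value, with the
    matrix entries of [f]; [M] sums the absolute values of all entries. *)
Lemma hom_hilbert_box_bounded (V W : finHilbertType R) (f : 'Hom(V, W)) :
  exists2 M : R, 0 <= M & forall x, @hilbert_box R V 1 x -> @hilbert_box R W M (f x).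
Proof.
pose e := @onbasis R V; pose e' := @onbasis R W.
pose a k l := `|dotp (f (tnth e l)) (tnth e' k)|.
exists (\sum_k \sum_l a k l) => [|x bx k].
  by do 2 apply: sumr_ge0 => ? _; exact: normr_ge0.
apply: (@le_trans _ _ (\sum_l a k l)).
  rewrite {1}(onbasis_expansion x) linear_sum dotp_suml (le_trans (ler_norm_sum _ _ _))//.
  apply: ler_sum => l _; rewrite linearZ/= dotpZl normrM ler_piMl ?normr_ge0//.
rewrite (bigD1 k)//= lerDl; do 2 apply: sumr_ge0 => ? _; exact: normr_ge0.
Qed.

End stretch.

Lemma powR_bounded_le0 (R : realType) (e C : R) :
  (forall t, 1 <= t -> t `^ e <= C) -> e <= 0.
Proof.
move=> tC; rewrite leNgt; apply/negP => e0.
have C1 : 1 <= C by have := tC 1 (lexx _); rewrite powR1.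
(* For this [t] the power is [C + 1], and [C1] guarantees [1 <= t]. *)
have := tC ((C + 1) `^ e^-1).
rewrite -powRrM mulVf ?gt_eqF// powRr1; last by lra.
have -> : 1 <= (C + 1) `^ e^-1.
  by rewrite -[leLHS](powRr0 (C + 1)) ler_powR ?invr_ge0 ?ltW//; lra.
by move=> /(_ isT); lra.
Qed.

Lemma powR_sum (R : realType) (t : R) (I : Type) (r : seq I) (P : pred I) (x : I -> R) :
  0 < t -> t `^ (\sum_(i <- r | P i) x i) = \prod_(i <- r | P i) t `^ x i.
Proof.
move=> t0; rewrite (big_morph (powR t) (id1 := 1) (op1 := *%R)) ?powRr0// => a b.
by rewrite powRD//; apply/implyP => _; rewrite gt_eqF.
Qed.

Section necessity.
Context {R : realType} {n m : nat}.
Variables (H : 'I_n -> finHilbertType R) (K : 'I_m -> finHilbertType R).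
Variable A : 'I_n -> 'I_m -> finType.
Variable B : forall (i : 'I_n) (j : 'I_m), A i j -> 'Hom(H i, K j).
Variable p : 'I_m -> \bar R.
Hypothesis p_ge1 : forall j, (1 <= p j)%E.

Section test_subspaces.
Variable V : forall i, {vspace H i}.

Let T i := stretch (spi1 (split_subspace (V i))) (spi2 (split_subspace (V i)))
  (spr1 (split_subspace (V i))) (spr2 (split_subspace (V i))).

Let S i j (a : A i j) := split_subspace (B a @: V i).

Let L i j (a : A i j) := stretch (spi1 (S a)) (spi2 (S a)) (spr1 (S a)) (spr2 (S a)).

Let dim_spV (U : finHilbertType R) (X : {vspace U}) :
  \dim {: spV (split_subspace X)} = \dim X.
Proof. by rewrite -(dim_splitting_inl (spP (split_subspace X))) spU. Qed.

(** Conjugated by the stretches, [B a] keeps its block from [V i] to [B a @: V i] ([F1]) and the one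
    between the complements ([F3]), has none from [V i] to the complement, and its last block ([F2])
    is divided by [t]. This is bounded for [t >= 1]; if every [V i] is the whole space, [F2]
    vanishes and any [t > 0] is allowed. *)
Let conjugate_bounded : exists2 M : R, 0 < M & forall t, 0 < t ->
  (1 <= t \/ forall i, V i = fullv) ->
  forall i j (a : A i j) (x : H i), @hilbert_box R (H i) 1 x ->
    @hilbert_box R (K j) M (L a t^-1 (B a (T i t x))).
Proof.
pose F1 i j (a : A i j) : 'Hom(H i, K j) := (spi1 (S a) \o (spr1 (S a) \o (B a \o
  (spi1 (split_subspace (V i)) \o spr1 (split_subspace (V i))))))%VF.
pose F2 i j (a : A i j) : 'Hom(H i, K j) := (spi1 (S a) \o (spr1 (S a) \o (B a \o
  (spi2 (split_subspace (V i)) \o spr2 (split_subspace (V i))))))%VF.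
pose F3 i j (a : A i j) : 'Hom(H i, K j) := (spi2 (S a) \o (spr2 (S a) \o (B a \o
  (spi2 (split_subspace (V i)) \o spr2 (split_subspace (V i))))))%VF.
have LE t i j (a : A i j) x : 0 < t ->
    L a t^-1 (B a (T i t x)) = F1 i j a x + t^-1 *: F2 i j a x + F3 i j a x.
  move=> t0; have kerS : lker (spr2 (S a)) = (B a @: V i)%VS.
    by rewrite (lker_splitting (spP (S a))) spU.
  have B0 v : spr2 (S a) (B a (spi1 (split_subspace (V i)) v)) = 0.
    apply/eqP; rewrite -memv_ker kerS; apply: memv_img.
    by have := memv_img (spi1 (split_subspace (V i))) (memvf v); rewrite spU.
  rewrite /F1 /F2 /F3 !comp_lfunE /L [LHS]stretchE /T stretchE.
  rewrite (linearD (B a)) linearZ/=.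
  rewrite (linearD (spr2 (S a))) linearZ/= B0 scaler0 add0r.
  rewrite (linearD (spr1 (S a))) linearZ/=.
  rewrite (linearD (spi1 (S a))) linearZ/=.
  by rewrite scalerDr scalerA mulVf ?gt_eqF// scale1r.
have bnd i j (a : A i j) : exists2 M : R, 0 <= M & forall t, 0 < t ->
    (1 <= t \/ forall i, V i = fullv) -> forall x, @hilbert_box R (H i) 1 x ->
    @hilbert_box R (K j) M (L a t^-1 (B a (T i t x))).
  have [M1 M10 M1P] := hom_hilbert_box_bounded (F1 i j a).
  have [M2 M20 M2P] := hom_hilbert_box_bounded (F2 i j a).
  have [M3 M30 M3P] := hom_hilbert_box_bounded (F3 i j a).
  exists (M1 + M2 + M3); first by rewrite !addr_ge0.
  move=> t t0 tV x bx k; rewrite LE// !dotpDl.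
  rewrite (le_trans (ler_normD _ _))// lerD//; last exact: M3P.
  rewrite (le_trans (ler_normD _ _))// lerD//; first exact: M1P.
  rewrite dotpZl normrM gtr0_norm ?invr_gt0//; case: tV => [t1|Vfull].
    rewrite (le_trans _ (M2P x bx k))// ler_piMl//.
    by rewrite invf_le1.
  rewrite (_ : F2 i j a x = 0) ?linear0l ?normr0 ?mulr0// /F2 !comp_lfunE/=.
  suff -> : spr2 (split_subspace (V i)) x = 0 by rewrite !linear0.
  apply/eqP; rewrite -memv_ker (lker_splitting (spP (split_subspace (V i)))) spU.
  by rewrite Vfull memvf.
have /choice[M MP] (u : {i : 'I_n & {j : 'I_m & A i j}}) : exists M : R, 0 <= M /\
    forall t, 0 < t -> (1 <= t \/ forall i, V i = fullv) -> forall x,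
    @hilbert_box R (H (tag u)) 1 x -> @hilbert_box R (K (tag (tagged u))) M
      (L (tagged (tagged u)) t^-1 (B (tagged (tagged u)) (T (tag u) t x))).
  by have [M M0 MP] := bnd _ _ (tagged (tagged u)); exists M.
(* The 1 keeps the common bound positive even if there are no arrows. *)
exists (1 + \sum_u M u).
  by rewrite ltr_wpDr// sumr_ge0// => u _; have [] := MP u.
move=> t t0 tV i j a x bx k.
have [_ /(_ t t0 tV x bx k) h] := MP (Tagged _ (Tagged (A i) a)).
apply: (le_trans h); rewrite (bigD1 (Tagged _ (Tagged (A i) a)))//= addrCA lerDl.
by rewrite addr_ge0// sumr_ge0// => u _; have [] := MP u.
Qed.

Definition BL_exponent : R := \sum_(i < n) (\dim (V i))%:R -
  \sum_(i < n) \sum_(j < m) \sum_(a : A i j) recip (p j) * (\dim (B a @: V i)%VS)%:R.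

(** The test sets are the unit box stretched by [t] along [V i] and the box of size [M] stretched by
    [t] along [B a @: V i]. By [conjugate_bounded], [M] does not depend on [t], and the volumes
    contribute exactly the power [BL_exponent] of [t]. *)
Lemma BL_exponent_bounded (C : R) : is_BLCD_constant B p C%:E ->
  exists C' : R, forall t, 0 < t -> (1 <= t \/ forall i, V i = fullv) ->
    t `^ BL_exponent <= C'.
Proof.
move=> hC; have [M M0 MP] := conjugate_bounded.
(* [P] and [D] collect the factors independent of [t] on the right and on the left. *)
pose P := \prod_(i < n) \prod_(j < m) \prod_(a : A i j) ((alpha A j)%:R `^ recip (p j)) : R.
pose D := \prod_(i < n) (2 ^+ \dim {: H i} * \prod_(j < m) \prod_(a : A i j)
  (((2 * M) ^+ \dim {: K j}) `^ (- recip (p j)))) : R.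
have D0 : 0 < D.
  apply: prodr_gt0 => i _; rewrite mulr_gt0 ?exprn_gt0//.
  by do 2 apply: prodr_gt0 => ? _; rewrite powR_gt0// exprn_gt0// mulr_gt0.
exists (C * P / D) => t t0 tV; rewrite ler_pdivlMr//.
have t'0 : t != 0 by rewrite gt_eqF.
pose sigma i j (a : A i j) : R := t ^+ \dim (B a @: V i) * (2 * M) ^+ \dim {: K j}.
have := @BLCD_test_sets _ _ _ _ _ _ _ _ p_ge1 C%:E
  (fun i => (T i t^-1 : borel (H i) -> borel (H i)) @^-1` hilbert_box 1)
  (fun i j a => (L a t^-1 : borel (K j) -> borel (K j)) @^-1` hilbert_box M)
  sigma hC.
have mpre (U : finHilbertType R) (f : 'End(U)) r :
    measurable ((f : borel U -> borel U) @^-1` hilbert_box r).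
  rewrite -[X in measurable X]setTI; apply: measurable_hom => //.
  exact: measurable_hilbert_box.
move=> /(_ (fun i => mpre _ _ _) (fun i j a => mpre _ _ _)).
have s0 i j (a : A i j) : 0 < sigma i j a by rewrite mulr_gt0 ?exprn_gt0// mulr_gt0.
move=> /(_ s0).
have SE i j (a : A i j) : lebesgue_hilbert (K j)
    ((L a t^-1 : borel (K j) -> borel (K j)) @^-1` hilbert_box M) = (sigma i j a)%:E.
  rewrite (lebesgue_hilbert_stretch (spP (S a)))//; last exact: measurable_hilbert_box.
  by rewrite lebesgue_hilbert_box// dim_spV EFinM.
move=> /(_ SE); have ES i j (a : A i j) (x : H i) :
    ((T i t^-1 : borel (H i) -> borel (H i)) @^-1` hilbert_box 1) x ->
    ((L a t^-1 : borel (K j) -> borel (K j)) @^-1` hilbert_box M) (B a x).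
  move=> bx; have := MP t t0 tV i j a _ bx.
  by rewrite /preimage /mkset /T (stretchK (spP (split_subspace (V i)))).
move=> /(_ ES).
rewrite (eq_bigr (fun i => (t `^ ((\dim (V i))%:R - \sum_(j < m) \sum_(a : A i j)
    recip (p j) * (\dim (B a @: V i)%VS)%:R) * (2 ^+ \dim {: H i} *
  \prod_(j < m) \prod_(a : A i j) (((2 * M) ^+ \dim {: K j}) `^ (- recip (p j)))))%:E)).
  under [X in (_ <= _ * X)%E -> _]eq_bigr do
    (under eq_bigr do rewrite prodEFin; rewrite prodEFin).
  rewrite !prodEFin -EFinM lee_fin big_split/= -/D -/P -powR_sum//.
  by rewrite sumrB.
move=> i _; rewrite (lebesgue_hilbert_stretch (spP _))//; last exact: measurable_hilbert_box.
rewrite lebesgue_hilbert_box// mulr1 dim_spV -!EFinM; congr EFin.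
rewrite powRD ?t'0 ?implybT// powR_mulrn ?(ltW t0)// -!mulrA; congr (_ * _).
rewrite mulrCA; congr (_ * _); rewrite -sumrN powR_sum// -big_split/=.
apply: eq_bigr => j _; rewrite -sumrN powR_sum// -big_split/=.
apply: eq_bigr => a _; rewrite /sigma powRM ?exprn_ge0 ?mulr_ge0 ?(ltW t0) ?(ltW M0)//.
by congr (_ * _); rewrite -powR_mulrn ?(ltW t0)// -powRrM mulrN mulrC.
Qed.

End test_subspaces.

Lemma BLCD_lty_condition : (forall i j (a : A i j), limg (B a) = {: K j}%VS) ->
    (BLCD B p < +oo)%E ->
  \sum_(i < n) (\dim {: H i})%:R =
    \sum_(j < m) (alpha A j)%:R * recip (p j) * (\dim {: K j})%:R :> R /\
  forall V : forall i : 'I_n, {vspace H i},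
    \sum_(i < n) (\dim (V i))%:R <= \sum_(i < n) \sum_(j < m) \sum_(a : A i j)
      recip (p j) * (\dim (B a @: V i)%VS)%:R :> R.
Proof.
move=> B_surj /ereal_inf_lt[[C| |] CP]//; last by case: CP.
move=> _.
have ineq V : BL_exponent V <= 0.
  have [C' C'P] := BL_exponent_bounded V CP.
  apply: (@powR_bounded_le0 _ _ C') => t t1; apply: C'P; last by left.
  exact: lt_le_trans t1.
split=> [|V]; last by rewrite -subr_le0; exact: ineq.
(* For the full spaces the bound also holds for [t < 1]; applied to [t^-1] it shows that the
   exponent is nonnegative. *)
have full0 : BL_exponent (fun=> fullv) = 0.
  apply/eqP; rewrite eq_le ineq/= -oppr_le0.
  have [C' C'P] := BL_exponent_bounded (fun=> fullv) CP.
  apply: (@powR_bounded_le0 _ _ C') => t t1.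
  have t0 : 0 < t by exact: lt_le_trans t1.
  rewrite -mulN1r powRrM powR_inv1 ?(ltW t0)//.
  by apply: C'P; [rewrite invr_gt0|right].
move/eqP: full0; rewrite /BL_exponent subr_eq0 => /eqP ->.
rewrite exchange_big/=; apply: eq_bigr => j _.
rewrite -mulrA /alpha natr_sum mulr_suml; apply: eq_bigr => i' _.
rewrite (eq_bigr (fun=> recip (p j) * (\dim {: K j})%:R)) => [|a _]; last by rewrite B_surj.
by rewrite sumr_const mulr_natl.
Qed.

End necessity.

Theorem corollary1p12 (R : realType) (n m : nat)
    (H : 'I_n -> finHilbertType R) (K : 'I_m -> finHilbertType R)
    (A : 'I_n -> 'I_m -> finType)
    (B : forall (i : 'I_n) (j : 'I_m), A i j -> 'Hom(H i, K j))
    (p : 'I_m -> \bar R)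
    (H_neq0 : forall i : 'I_n, {: H i}%VS != 0%VS)
    (K_neq0 : forall j : 'I_m, {: K j}%VS != 0%VS)
    (B_surj : forall (i : 'I_n) (j : 'I_m) (a : A i j),
      limg (B i j a) = {: K j}%VS)
    (p_ge1 : forall j : 'I_m, (1 <= p j)%E) :
  (BLCD B p < +oo)%E <->
  (\sum_(i < n) (\dim {: H i})%:R
     = \sum_(j < m) (alpha A j)%:R * recip (p j) * (\dim {: K j})%:R :> R) /\
  (forall V : forall i : 'I_n, {vspace H i},
     \sum_(i < n) (\dim (V i))%:R
       <= \sum_(i < n) \sum_(j < m) \sum_(a : A i j)
            recip (p j) * (\dim (B i j a @: V i)%VS)%:R :> R).
Proof.
split=> [|[full sub]]; first exact: BLCD_lty_condition.
exact: BLCD_lty.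
Qed.
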